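(* The $\Pi^1_1\!\downarrow$-LST property of Stationary Logic holds if and only if $\text{DRP}_{\text{internal}}$ holds.
   Context: Work in ZFC. ''Structure'' always means a first order structure in a countable signature. For a structure $\mathfrak{A}=(A,\dots)$ and $W\subseteq A$, $\mathfrak{A}|W$ denotes the restriction of $\mathfrak{A}$ to $W$ (the substructure with universe $W$). $[A]^\omega$ denotes the set of countable subsets of $A$; $S\subseteq[A]^\omega$ is stationary (in $[A]^\omega$) if it meets every closed unbounded subset of $[A]^\omega$ (Jech's sense); equivalently, for every $f:[A]^{<\omega}\to A$ some element of $S$ is closed under $f$. Stationary Logic extends first order logic (first order variables written in lowercase) by second order variables (uppercase), atomic formulas $Z(x)$ (meaning $x\in Z$), and a second order quantifier $\text{stat}$; second order variables range over countable subsets of the universe. Satisfaction is defined recursively, with the clause: $\mathfrak{A}\models \text{stat} Z\ \phi(Z,U_1,\dots,U_\ell,p_1,\dots,p_k)$ iff $\{Z\in[A]^\omega : \mathfrak{A}\models\phi(Z,U_1,\dots,U_\ell,p_1,\dots,p_k)\}$ is stationary in $[A]^\omega$. The quantifier $\text{aa} Z\,\phi$ abbreviates $\neg\,\text{stat} Z\,\neg\phi$. A formula without second order quantifiers is called $\Sigma^1_0$ or $\Pi^1_0$. A $\Pi^1_1$ formula is one of the form $\text{stat} Z_1\cdots\text{stat} Z_k\ \phi(Z_1,\dots,Z_k,\dots)$ with $\phi$ a formula without second order quantifiers. The $\Pi^1_1\!\downarrow$-LST property holds for Stationary Logic iff for every structure $\mathfrak{A}=(A,\dots)$ there exists $W\subseteq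 A$ of size $\le\omega_1$ such that for all $\Pi^1_1$ formulas $\phi$ in Stationary Logic with no free occurrences of second order variables, and all first order parameters $p_1,\dots,p_k\in W$: if $\mathfrak{A}\models\phi[\vec p]$, then $\mathfrak{A}|W\models\phi[\vec p]$. $\text{DRP}_{\text{internal}}$ asserts that for every sufficiently large regular $\theta$, there are stationarily many $W\in\wp_{\omega_2}(H_\theta)$ (subsets of $H_\theta$ of size less than $\omega_2$) such that: (i) $|W|=\omega_1\subset W$; and (ii) whenever $A\in W$ is uncountable and $S\in W$ is a stationary subset of $[A]^\omega$, the set $S\cap W\cap[W\cap A]^\omega$ is stationary in $[W\cap A]^\omega$. *)

(* Defs.v *)
From HB Require Import structures.
From mathcomp Require Import all_boot generic_quotient.
From mathcomp Require Import boolp classical_sets functions cardinality.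

Set Implicit Arguments.
Unset Strict Implicit.
Unset Printing Implicit Defensive.

Local Open Scope classical_set_scope.
Local Open Scope quotient_scope.
Local Open Scope card_scope.

(* The universe of sets: well-founded trees (Aczel) modulo extensional
   equality, so that equality of sets is Leibniz equality.  The lemmas
   [V_ext] to [V_choice] below are the ZFC axioms, with arbitrary predicates
   and functions on [V] in separation and replacement. *)
Inductive ens : Type := mkens (D : Type) (f : D -> ens).

Fixpoint ens_eq (x y : ens) : Prop :=
  match x, y with
  | mkens D f, mkens E g =>
      (forall i, exists j, ens_eq (f i) (g j)) /\
      (forall j, exists i, ens_eq (f i) (g j))
  end.

Definition ens_in (x y : ens) : Prop :=
  match y with mkens E g => exists j, ens_eq x (g j) end.

Lemma ens_eq_refl x : ens_eq x x.
Proof. by elim: x => D f IH /=; split=> i; exists i. Qed.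

Lemma ens_eq_sym x y : ens_eq x y -> ens_eq y x.
Proof.
elim: x y => D f IH [E g] /= [h1 h2]; split=> [j|i].
  by have [i ?] := h2 j; exists i; apply: IH.
by have [j ?] := h1 i; exists j; apply: IH.
Qed.

Lemma ens_eq_trans x y z : ens_eq x y -> ens_eq y z -> ens_eq x z.
Proof.
elim: x y z => D f IH [E g] [K h] /= [h1 h2] [h3 h4]; split=> [i|k].
  by have [j ?] := h1 i; have [k ?] := h3 j; exists k; apply: IH; eauto.
by have [j ?] := h4 k; have [i ?] := h2 j; exists i; apply: IH; eauto.
Qed.

HB.instance Definition _ := gen_eqMixin ens.
HB.instance Definition _ := gen_choiceMixin ens.

Definition ens_eqb : rel ens := fun x y => `[< ens_eq x y >].

Lemma ens_eqb_refl : reflexive ens_eqb.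
Proof. by move=> x; apply/asboolP/ens_eq_refl. Qed.

Lemma ens_eqb_sym : symmetric ens_eqb.
Proof. by move=> x y; apply/asboolP/asboolP => /ens_eq_sym. Qed.

Lemma ens_eqb_trans : transitive ens_eqb.
Proof.
move=> y x z /asboolP xy /asboolP yz.
exact/asboolP/(ens_eq_trans xy yz).
Qed.

Canonical ens_equiv := EquivRel ens_eqb ens_eqb_refl ens_eqb_sym ens_eqb_trans.

Definition V : Type := {eq_quot ens_equiv}.

Definition V_of (x : ens) : V := \pi_{eq_quot ens_equiv} x.

(* [elts y x] is the membership relation x ∈ y. *)
Definition elts (y : V) : set V :=
  [set x : V | ens_in (repr (x : {eq_quot ens_equiv}))
                      (repr (y : {eq_quot ens_equiv}))].

Lemma V_of_repr (x : V) : V_of (repr (x : {eq_quot ens_equiv})) = x.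
Proof. exact: reprK. Qed.

Lemma V_of_eq x y : V_of x = V_of y <-> ens_eq x y.
Proof.
split=> [/eqP|h]; last by apply/eqP; rewrite /V_of eqmodE; apply/asboolP.
by rewrite /V_of eqmodE => /asboolP.
Qed.

Lemma repr_V_of x : ens_eq (repr (V_of x : {eq_quot ens_equiv})) x.
Proof. by apply/V_of_eq; rewrite V_of_repr. Qed.

Lemma elts_family (D : Type) (f : D -> ens) :
  elts (V_of (mkens f)) = range (V_of \o f).
Proof.
apply/seteqP; split=> x; rewrite /elts /=.
  case: (repr (V_of _)) (repr_V_of (mkens f)) => J g /= [h1 h2] [j xj].
  have [i ij] := h1 j; exists i => //=.
  rewrite -(V_of_repr x); apply/V_of_eq/ens_eq_sym.
  exact: ens_eq_trans xj ij.
move=> [i _ <-] /=.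
case: (repr (V_of (mkens f))) (repr_V_of (mkens f)) => J g /= [h1 h2].
have [j ij] := h2 i; exists j.
by apply: ens_eq_trans (repr_V_of (f i)) _; exact: ens_eq_sym.
Qed.

Lemma V_family (x : V) :
  exists (D : Type) (f : D -> ens), x = V_of (mkens f).
Proof.
rewrite -(V_of_repr x); case: (repr (x : {eq_quot ens_equiv})) => I f.
by exists I, f.
Qed.

Lemma V_ext (x y : V) : elts x = elts y -> x = y.
Proof.
have [I [f ->]] := V_family x; have [J [g ->]] := V_family y.
rewrite !elts_family => e; apply/V_of_eq; split=> [i|j].
  have : range (V_of \o f) (V_of (f i)) by exists i.
  by rewrite e => -[j _ /V_of_eq/ens_eq_sym ?]; exists j.
have : range (V_of \o g) (V_of (g j)) by exists j.
by rewrite -e => -[i _ /V_of_eq ?]; exists i.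
Qed.

Lemma V_foundation : well_founded (fun x y : V => elts y x).
Proof.
move=> x; rewrite -(V_of_repr x); elim: (repr _) => D f IH.
by split=> y; rewrite elts_family => -[i _ <-]; apply: IH.
Qed.

Lemma V_replacement (x : V) (F : V -> V) : exists y, elts y = F @` elts x.
Proof.
have [I [f ->]] := V_family x.
exists (V_of (mkens (fun i => repr (F (V_of (f i)) : {eq_quot ens_equiv})))).
rewrite !elts_family; apply/seteqP; split=> [_ [i _ <-]|_ [_ [i _ <-] <-]] /=.
  by exists (V_of (f i)); rewrite ?V_of_repr //; exists i.
by exists i; rewrite //= V_of_repr.
Qed.

Lemma V_separation (x : V) (P : set V) : exists y, elts y = elts x `&` P.
Proof.
have [I [f ->]] := V_family x.
exists (V_of (mkens (fun i : {i | P (V_of (f i))} => f (sval i)))).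
rewrite !elts_family; apply/seteqP; split=> [_ [[i Pi] _ <-]|_ [[i _ <-] Pi]].
  by split=> //; exists i.
by exists (exist _ i Pi).
Qed.

Definition branches (u : ens) := let: @mkens D _ := u in D.

Definition branch (u : ens) : branches u -> ens :=
  match u with mkens _ g => g end.

Lemma V_union (x : V) : exists y, elts y = \bigcup_(z in elts x) elts z.
Proof.
have [I [f ->]] := V_family x.
have fE i : f i = mkens (@branch (f i)) by case: (f i).
exists (V_of (mkens (fun p : {i & branches (f i)} => branch (projT2 p)))).
rewrite !elts_family; apply/seteqP; split.
  move=> _ [[i j] _ <-] /=; exists (V_of (f i)); first by exists i.
  by rewrite [in elts _]fE elts_family; exists j.
move=> y [_ [i _ <-]] /=; rewrite fE elts_family => -[j _ <-].
by exists (existT _ i j).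
Qed.

Lemma V_power (x : V) : exists y, elts y = [set z | elts z `<=` elts x].
Proof.
have [I [f ->]] := V_family x.
exists (V_of (mkens (fun P : I -> Prop => mkens (fun i : {i | P i} => f (sval i))))).
rewrite !elts_family; apply/seteqP; split=> [_ [P _ <-]|z zx] /=.
  by rewrite elts_family => _ [[i Pi] _ <-]; exists i.
exists (fun i => elts z (V_of (f i))) => //=.
apply: V_ext; rewrite elts_family; apply/seteqP; split=> [_ [[i zi] _ <-]//|y zy].
have [i _ yE] := zx _ zy.
have zi : elts z (V_of (f i)) by rewrite [V_of _]yE.
by exists (exist _ i zi).
Qed.

Lemma V_pairing (x y : V) : exists z, elts z = [set x; y].
Proof.
exists (V_of (mkens (fun b : bool =>
  repr ((if b then x else y) : {eq_quot ens_equiv})))).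
rewrite elts_family; apply/seteqP; split=> [_ [[] _ <-]|_ [->|->]] /=.
- by left; rewrite V_of_repr.
- by right; rewrite V_of_repr.
- by exists true; rewrite //= V_of_repr.
- by exists false; rewrite //= V_of_repr.
Qed.

Lemma V_infinity : exists w : V,
  (exists2 e, elts w e & elts e = set0) /\
  (forall x, elts w x -> exists2 y, elts w y & elts y = elts x `|` [set x]).
Proof.
pose nxt (u : ens) := mkens (fun o : option (branches u) =>
  if o is Some j then branch j else u).
have nxtE u : elts (V_of (nxt u)) = elts (V_of u) `|` [set V_of u].
  case: u => J g; rewrite !elts_family; apply/seteqP; split.
    by move=> _ [[j|] _ <-] /=; [left; exists j|right].
  by move=> _ [[j _ <-]|->] /=; [exists (Some j)|exists None].
pose emp := mkens (fun v : void => match v return ens with end).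
exists (V_of (mkens (fun n => iter n nxt emp))); rewrite elts_family; split.
  exists (V_of emp); first by exists 0.
  by rewrite elts_family; apply/seteqP; split=> // y [[]].
move=> _ [n _ <-]; exists (V_of (iter n.+1 nxt emp)); first by exists n.+1.
exact: nxtE.
Qed.

Lemma V_choice (x : V) : (forall y, elts x y -> elts y !=set0) ->
  exists F : V -> V, forall y, elts x y -> elts y (F y).
Proof.
by move=> ne; exists (fun y => xget y (elts y)) => y /ne[z]; exact: xgetI.
Qed.

(* Foundation makes the order given by ∈ well-founded, so linearity is enough. *)
Definition ordinal_V (a : V) : Prop :=
  (forall b, elts a b -> elts b `<=` elts a) /\
  (forall b c, elts a b -> elts a c -> [\/ elts b c, b = c | elts c b]).

Definition omega1 : set V := [set a | ordinal_V a /\ countable (elts a)].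

Definition cardinal_V (k : V) : Prop :=
  ordinal_V k /\ forall a, elts k a -> ~~ (elts k #<= elts a).

Definition regular_V (k : V) : Prop :=
  [/\ cardinal_V k, [set: nat] #<= elts k &
      forall X : set V, X `<=` elts k ->
        (forall a, elts k a -> exists2 b, X b & a = b \/ elts b a) ->
        elts k #<= X].

Definition trcl (x : V) : set V :=
  smallest [set X : set V | forall y, X y -> elts y `<=` X] (elts x).

Definition H (theta : V) : set V :=
  [set x | (trcl x #<= elts theta) && ~~ (elts theta #<= trcl x)].

Section Stationary.
Variables (U T : Type) (B : set U) (A : set T).

(* P_kappa(A), where kappa is the successor cardinal of |B|: a set has size
   < kappa iff it has size <= |B|.  With B := nat this is [A]^omega (kappa =
   omega_1); with B := omega1 this is P_(omega_2)(A). *)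
Definition subsets_le : set (set T) := [set X | X `<=` A /\ X #<= B].

(* Jech: unions of increasing chains of length a, for nonzero ordinals
   a < kappa. *)
Definition closed_in (C : set (set T)) : Prop :=
  forall (a : V) (s : V -> set T),
    ordinal_V a -> elts a !=set0 -> elts a #<= B ->
    (forall i, elts a i -> C (s i)) ->
    (forall i j, elts a i -> elts a j -> elts j i -> s i `<=` s j) ->
    C (\bigcup_(i in elts a) s i).

Definition unbounded_in (C : set (set T)) : Prop :=
  forall X, subsets_le X -> exists2 Y, C Y & X `<=` Y.

Definition club (C : set (set T)) : Prop :=
  [/\ C `<=` subsets_le, closed_in C & unbounded_in C].

Definition stationary (S : set (set T)) : Prop :=
  S `<=` subsets_le /\ forall C, club C -> C `&` S !=set0.

End Stationary.

(* The countable subsets of A: [X #<= [set: nat]] is [countable X]. *)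
Notation ctbl_subsets A := (subsets_le [set: nat] A).
Notation stationary_ctbl A := (stationary [set: nat] A).

Record signature := Signature {
  fsym : countType;
  farity : fsym -> nat;
  rsym : countType;
  rarity : rsym -> nat }.

Record structure (L : signature) (T : Type) := Structure {
  nonempty : inhabited T;
  fint : forall f : fsym L, ('I_(farity f) -> T) -> T;
  rint : forall r : rsym L, ('I_(rarity r) -> T) -> Prop }.

Record substructure L T (M : structure L T) (W : set T) : Prop := Substructure {
  sub_nonempty : inhabited W;
  sub_closed : forall (f : fsym L) (a : 'I_(farity f) -> T),
    (forall i, W (a i)) -> W (fint M a) }.

Definition restrict L T (M : structure L T) (W : set T)
    (hW : substructure M W) : structure L W :=
  {| nonempty := sub_nonempty hW;
     fint := fun (f : fsym L) (a : 'I_(farity f) -> W) =>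
       exist _ (fint M (fun i => val (a i)))
         (mem_set (sub_closed hW (fun i => set_valP (a i))));
     rint := fun (r : rsym L) (a : 'I_(rarity r) -> W) =>
       rint M (fun i => val (a i)) |}.

Section StationaryLogic.
Variable L : signature.

Inductive term :=
| Var (x : nat)
| App (f : fsym L) (a : 'I_(farity f) -> term).

(* First and second order variables are two separate copies of nat. *)
Inductive formula :=
| FEq (t u : term)
| FRel (r : rsym L) (a : 'I_(rarity r) -> term)
| FMem (Z x : nat)
| FNot (p : formula)
| FAnd (p q : formula)
| FEx (x : nat) (p : formula)
| FStat (Z : nat) (p : formula).

Fixpoint no_stat (p : formula) : bool :=
  match p with
  | FEq _ _ | FRel _ _ | FMem _ _ => true
  | FNot p | FEx _ p => no_stat p
  | FAnd p q => no_stat p && no_stat q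
  | FStat _ _ => false
  end.

Inductive Pi11 : formula -> Prop :=
| Pi11_base p : no_stat p -> Pi11 p
| Pi11_stat Z p : Pi11 p -> Pi11 (FStat Z p).

Fixpoint free2 (p : formula) (Y : nat) : bool :=
  match p with
  | FEq _ _ | FRel _ _ => false
  | FMem Z _ => Y == Z
  | FNot p | FEx _ p => free2 p Y
  | FAnd p q => free2 p Y || free2 q Y
  | FStat Z p => (Y != Z) && free2 p Y
  end.

Variables (T : Type) (M : structure L T).

Fixpoint eval (v : nat -> T) (t : term) : T :=
  match t with
  | Var x => v x
  | App f a => fint M (fun i => eval v (a i))
  end.

Fixpoint sat (v : nat -> T) (w : nat -> set T) (p : formula) : Prop :=
  match p with
  | FEq t u => eval v t = eval v u
  | FRel r a => rint M (fun i => eval v (a i))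
  | FMem Z x => w Z (v x)
  | FNot p => ~ sat v w p
  | FAnd p q => sat v w p /\ sat v w q
  | FEx x p => exists a, sat [eta v with x |-> a] w p
  | FStat Z p => stationary_ctbl [set: T]
      [set X | ctbl_subsets [set: T] X /\ sat v [eta w with Z |-> X] p]
  end.

End StationaryLogic.

(* Structures have a set of V as universe.  The parameters p_1, ..., p_k are
   given by an assignment v of the first order variables in W; the second
   order assignment is irrelevant since p has no free second order variable. *)
Definition Pi11_LST : Prop :=
  forall (L : signature) (A : V) (M : structure L (elts A)),
  exists (W : set (elts A)) (hW : substructure M W),
    W #<= omega1 /\
    forall p : formula L, Pi11 p -> (forall Z, ~~ free2 p Z) ->
    forall v : nat -> W,
      sat M (fun x => val (v x)) (fun=> set0) p ->
      sat (restrict hW) v (fun=> set0) p.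

Definition DRP_internal : Prop :=
  exists theta0 : V, ordinal_V theta0 /\
  forall theta : V, regular_V theta -> elts theta theta0 ->
    stationary omega1 (H theta)
      [set W | [/\ subsets_le omega1 (H theta) W,
        W #= omega1, omega1 `<=` W &
        forall A S : V, W A -> ~ countable (elts A) ->
          W S -> stationary_ctbl (elts A) (elts @` elts S) ->
          stationary_ctbl (W `&` elts A)
            ((elts @` (elts S `&` W)) `&` ctbl_subsets (W `&` elts A))]].

(* Main.v *)
From HB Require Import structures.
From Stdlib Require Import Relations Wellfounded Wf_nat.
From mathcomp Require Import all_boot finmap generic_quotient.
From mathcomp Require Import boolp classical_sets functions cardinality.
Require Import Defs.

Set Implicit Arguments.
Unset Strict Implicit.
Unset Printing Implicit Defensive.

Local Open Scope classical_set_scope.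
Local Open Scope card_scope.
Local Open Scope quotient_scope.

(** Both properties say that stationary sets reflect to some [W] of size
    [omega1]: the logical one speaks of formulas, [DRP_internal] of stationary
    sets that are elements of [W].

    From logic to sets ([LST_DRP]).  Let [theta] be regular above [omega1], and
    let a club [C] of sets of size at most [omega1] in [H theta] be given.  Put
    on [H theta] the relation of membership together with countably many
    functions.  Two formulas are enough.  In [H theta], stationarily many [Z]
    fail to contain [omega1] ([f_escape]); as this passes to [W], the set
    [W `&` omega1] is uncountable, hence all of [omega1] once [W] contains the
    elements of its countable elements.  And if [S] is stationary in the
    countable subsets of [a], then by the upward projection theorem
    ([stationary_lift]) stationarily many [Z] have [Z `&` a] in [S] ([f_trace]);
    in [W] this says that the trace of [S] is stationary.  That [W] lies in [C]
    is arranged by the functions of the structure, because a club contains every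
    [W] closed under a suitable function defined on finite sets
    ([club_monotone_choice], [fset_hull_omega1]).

    From sets to logic ([DRP_LST]).  Given a structure on [A], choose [theta]
    regular with the subsets of [A] and the sets of subsets of [A] in [H theta]
    ([regular_above]), and take [W] as in [DRP_internal], closed under Skolem
    functions and under the maps that send parameters to the set of countable
    solutions [Z] of a formula, and containing the elements of its countable
    elements ([hull_step]).  Then
    [sat_restrict_Pi11] shows by induction that a formula [stat Z p] true in the
    structure stays true in its restriction to [W]: the set of solutions is a
    stationary element of [W], so its trace is stationary, and a member [X] of
    the trace is an element of [W], so that the induction hypothesis applies to
    [p] with [X] as second order parameter.

    The remaining lemmas supply set theory for [V]: bounds on unions indexed by
    sets with as many elements as their square, the ordinals below the Hartogs
    number of a type (this gives [omega1] and regular [theta]), and the fact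
    that [H theta] is a set, by Mostowski collapse. *)

(** Membership in lists and finite sets of elements of [V] needs these. *)
HB.instance Definition _ := gen_eqMixin V.
HB.instance Definition _ := gen_choiceMixin V.

(** * Cardinal arithmetic *)

Lemma card_le_inj T U (A : set T) (B : set U) (f : T -> U) :
  (forall x, A x -> B (f x)) ->
  (forall x y, A x -> A y -> f x = f y -> x = y) -> A #<= B.
Proof.
move=> fAB fI.
have: $|{injfun A >-> B}|.
  apply/injfunPex; exists f => [x /fAB//|x y /set_mem Ax /set_mem Ay].
  exact: fI.
by case=> g; exact: inj_card_le g.
Qed.

(** [#<=] compares the subtypes, whose injections extend to the ambient type
    only if the target is inhabited. *)
Lemma card_le_injP T U (A : set T) (B : set U) (u0 : U) : A #<= B ->
  exists f : T -> U, (forall x, A x -> B (f x)) /\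
    (forall x y, A x -> A y -> f x = f y -> x = y).
Proof.
move=> /card_leP [f].
have /injfunPex[g gAB gI] : $|{injfun A >-> B}| by squash (valLR u0 f).
exists g; split=> [x /gAB//|x y Ax Ay].
by apply: gI; exact/mem_set.
Qed.

Lemma card_le_surj T U (A : set T) (B : set U) (x0 : T) : A #<= B ->
  exists g : U -> T, A `<=` g @` B.
Proof.
move=> AB; have [[u0 _]|B0] := pselect (B !=set0); last first.
  exists (fun=> x0) => x Ax; case: B0.
  move: AB => /card_leP[f]; have := f (SigSub (mem_set Ax)).
  by move=> [u /set_mem Bu]; exists u.
have [f [fAB fI]] := card_le_injP u0 AB.
have : forall u, exists x, forall y, A y -> f y = u -> x = y.
  move=> u; have [[y [Ay fy]]|ny] := pselect (exists y, A y /\ f y = u).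
    by exists y => z Az fz; apply: fI => //; rewrite fz.
  by exists x0 => y Ay fy; case: ny; exists y.
move=> /choice[g gP]; exists g => x Ax.
by exists (f x); [exact: fAB|exact: gP].
Qed.

Lemma card_le_bigcup_setX I T U (D : set I) (A : I -> set T) (B : set U) :
  (forall i, D i -> A i #<= B) -> \bigcup_(i in D) A i #<= D `*` B.
Proof.
move=> AB; have [[x0 _]|/set0P/negP/negPn/eqP->] :=
  pselect (\bigcup_(i in D) A i !=set0); last exact: card_ge0.
have : forall i, exists g : U -> T, D i -> A i `<=` g @` B.
  move=> i; have [Di|nDi] := pselect (D i); last by exists (fun=> x0).
  by have [g gP] := card_le_surj x0 (AB i Di); exists g.
move=> /choice[g gP]; apply: card_le_trans (card_image_le (fun p => g p.1 p.2) _).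
apply: subset_card_le => x [i Di /(gP _ Di)[u Bu <-]].
by exists (i, u).
Qed.

Lemma card_le_setX I J T U (A : set I) (A' : set J) (B : set T) (B' : set U) :
  A #<= B -> A' #<= B' -> A `*` A' #<= B `*` B'.
Proof.
move=> AB AB'.
have [[[i j] _]|/set0P/negP/negPn/eqP->] := pselect (A `*` A' !=set0); last first.
  exact: card_ge0.
have [f fP] := card_le_surj i AB; have [g gP] := card_le_surj j AB'.
apply: card_le_trans (card_image_le (fun p => (f p.1, g p.2)) _).
apply: subset_card_le => -[x y] [/= /fP[a Ba <-] /gP[b Bb <-]].
by exists (a, b).
Qed.

(** The instances are [nat], [omega1] and types of functions on [nat], whose
    squares are bounded directly, without the theorem on squares of arbitrary
    infinite cardinals. *)
Section SquareAbsorbing.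
Variables (U : Type) (B : set U).
Hypotheses (Binf : [set: nat] #<= B) (Bsq : B `*` B #<= B).

Lemma card_le_bigcup I T (D : set I) (A : I -> set T) :
  D #<= B -> (forall i, D i -> A i #<= B) -> \bigcup_(i in D) A i #<= B.
Proof.
move=> DB AB; apply: card_le_trans (card_le_bigcup_setX AB) _.
exact: card_le_trans (card_le_setX DB (card_lexx _)) Bsq.
Qed.

Lemma countable_card_le T (A : set T) : countable A -> A #<= B.
Proof. by move=> cA; exact: card_le_trans cA Binf. Qed.

Lemma card_le_setU T (A A' : set T) : A #<= B -> A' #<= B -> A `|` A' #<= B.
Proof.
move=> AB AB'; rewrite -bigcup2E.
apply: card_le_bigcup => [//|[|[|i]] _ //=]; exact: card_ge0.
Qed.

Lemma card_le_seqs (T : eqType) (A : set T) : A #<= B ->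
  [set s : seq T | forall x, x \in s -> A x] #<= B.
Proof.
move=> AB.
pose L n := [set s : seq T | size s = n /\ forall x, x \in s -> A x].
have LB n : L n #<= B.
  elim: n => [|n IH].
    apply: countable_card_le; apply: (sub_countable (B := [set [::] : seq T])).
      by apply: subset_card_le => s [/size0nil].
    exact: countable1.
  have : L n.+1 `<=` \bigcup_(x in A) (cons x @` L n).
    move=> [|x s] [//= [sn] As]; exists x; first by apply: As; rewrite mem_head.
    by exists s => //; split=> // y ys; apply: As; rewrite inE ys orbT.
  move=> /subset_card_le/card_le_trans; apply.
  apply: card_le_bigcup => // x _.
  exact: card_le_trans (card_image_le _ _) IH.
have : [set s : seq T | forall x, x \in s -> A x] `<=` \bigcup_(n in setT) L n.
  by move=> s As; exists (size s).
move=> /subset_card_le/card_le_trans; apply.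
exact: card_le_bigcup.
Qed.

End SquareAbsorbing.

Lemma card_nat_setX : [set: nat] `*` [set: nat] #<= [set: nat].
Proof. exact: countableX. Qed.

(** Send the points of [D] recursively to fresh points of [B]; if this breaks
    down at [x], then the points below [x] have already exhausted [B]. *)
Lemma wf_compare T U (R : T -> T -> Prop) (D : set T) (B : set U) :
  well_founded R ->
  (forall x y, D x -> D y -> [\/ R x y, x = y | R y x]) ->
  D #<= B \/ exists2 x, D x & B #<= [set y | D y /\ R y x].
Proof.
move=> wfR tot.
pose P x (rec : forall y, R y x -> option U) u :=
  B u /\ forall y (h : R y x), D y -> rec y h <> Some u.
pose step x rec : option U :=
  if pselect (exists u, P x rec u) is left h then Some (projT1 (cid h)) else None.
pose f := Fix wfR (fun=> option U) step.
have fE x : f x = step x (fun y _ => f y).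
  rewrite /f Fix_eq // => {}x g h gh; congr (step x _).
  by apply: functional_extensionality_dep => y;
     apply: functional_extensionality_dep => yx; exact: gh.
have [allS|] := pselect (forall x, D x -> exists u, f x = Some u).
  left; have fS x u : f x = Some u -> P x (fun y _ => f y) u.
    by rewrite fE /step; case: pselect => // h [<-]; exact: projT2 (cid h).
  apply: (@card_le_trans _ _ _ (some @` B)); last exact: card_image_le.
  apply: (card_le_inj (f := f)) => [x Dx|x y Dx Dy fxy].
    by have [u fx] := allS x Dx; have [Bu _] := fS _ _ fx; exists u.
  have [u fx] := allS x Dx; have fy : f y = Some u by rewrite -fxy.
  have [_ hx] := fS _ _ fx; have [_ hy] := fS _ _ fy.
  by case: (tot x y Dx Dy) => // r; [case: (hy _ r Dx)|case: (hx _ r Dy)].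
move=> /existsNP[x /not_implyP[Dx nS]]; right; exists x => //.
have: some @` B `<=` f @` [set y | D y /\ R y x].
  move=> _ [u Bu <-]; apply: contrapT => nu; apply: nS.
  rewrite fE /step; case: pselect => [h|nh]; first by eexists.
  case: nh; exists u; split=> // y yx Dy fy; apply: nu; by exists y.
move=> /subset_card_le/card_le_trans/(_ (card_image_le _ _)).
by rewrite card_ge_some.
Qed.

(** * Sets and ordinals *)

Lemma elts_acyclic (x y z : V) : elts x y -> elts y z -> ~ elts z x.
Proof.
move=> xy yz zx; have wfT := wf_clos_trans _ _ V_foundation.
have : clos_trans V (fun a b => elts b a) x x.
  apply: (t_trans _ _ _ z); first exact: t_step.
  by apply: (t_trans _ _ _ y); exact: t_step.
elim/(well_founded_ind wfT): x {xy yz zx} => x IH xx; exact: (IH x).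
Qed.

Lemma elts_irrefl (x : V) : ~ elts x x.
Proof. by move=> xx; exact: (elts_acyclic xx xx). Qed.

Lemma elts_asym (x y : V) : elts x y -> ~ elts y x.
Proof.
move=> xy yx; elim/(well_founded_ind V_foundation): x y xy yx => x IH y xy yx.
exact: (IH y xy x).
Qed.

Definition is_set (P : set V) := exists x, elts x = P.

Lemma is_set_range (D : Type) (f : D -> V) : is_set (range f).
Proof.
exists (V_of (mkens (fun d => repr (f d : {eq_quot ens_equiv})))).
rewrite elts_family; congr (_ @` _); apply: funext => d /=; exact: V_of_repr.
Qed.

Lemma is_set_sub (x : V) (P : set V) : P `<=` elts x -> is_set P.
Proof.
move=> Px; have [y yE] := V_separation x P; exists y.
by rewrite yE setIidr.
Qed.

Lemma is_set0 : is_set set0.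
Proof. by have [w [[e _ e0] _]] := V_infinity; exists e. Qed.

Lemma is_setU (x y : V) : is_set (elts x `|` elts y).
Proof.
have [p pE] := V_pairing x y; have [u uE] := V_union p; exists u.
by rewrite uE pE bigcup_setU !bigcup_set1.
Qed.

Lemma is_set1 (x : V) : is_set [set x].
Proof. by have [p pE] := V_pairing x x; exists p; rewrite pE setUid. Qed.

(** [transitive_le_bounded] needs a type small enough to index the branches of
    a tree, which [elts x] itself, a subset of [V], is not. *)
Lemma card_le_small_type (x : V) : exists D : Type, elts x #<= [set: D].
Proof.
have [D [f ->]] := V_family x; exists D; rewrite elts_family.
exact: card_image_le.
Qed.

Definition transitive_set (t : set V) := forall y, t y -> elts y `<=` t.

Lemma trcl_sub x : elts x `<=` trcl x.
Proof. exact: sub_smallest. Qed.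

Lemma trcl_trans x : transitive_set (trcl x).
Proof. by move=> y xy z yz X [tX xX]; apply: (tX y) yz; apply: xy. Qed.

Lemma trcl_min x (t : set V) : transitive_set t -> elts x `<=` t -> trcl x `<=` t.
Proof. by move=> tt xt y; apply. Qed.

(** This replaces the transitive closure, of which [trcl] is only the class. *)
Lemma in_transitive_set (x : V) : exists2 k : V, transitive_set (elts k) & elts x `<=` elts k.
Proof.
elim/(well_founded_ind V_foundation): x => x IH.
have : forall y, exists k, elts x y -> transitive_set (elts k) /\ elts y `<=` elts k.
  move=> y; have [xy|nxy] := pselect (elts x y); last by exists x => /nxy.
  by have [k kt yk] := IH y xy; exists k.
move=> /choice[k kP]; have [r rE] := V_replacement x k.
have [u uE] := V_union r; have [v vE] := is_setU x u.
exists v; rewrite vE uE rE bigcup_image; last by move=> y; left.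
move=> y [xy|[z xz zy]] w yw; right.
  by exists y => //; exact: (kP y xy).2 yw.
by exists z => //; exact: (kP z xz).1 zy _ yw.
Qed.

(** A transitive set of size at most that of [Y] is the Mostowski collapse of a
    well-founded relation on [Y], and such relations form a set.  Hence, up to a
    bound on the size of transitive closures, classes are sets. *)
Lemma transitive_le_bounded (Y : Type) (y0 : Y) : exists h : V,
  forall x (t : set V), transitive_set t -> elts x `<=` t -> t #<= [set: Y] ->
  elts h x.
Proof.
pose c R (wf : well_founded R) : Y -> ens := Fix wf (fun=> ens)
  (fun y rec => mkens (fun z : {z | R z y} => rec (sval z) (svalP z))).
have cE R wf y : @c R wf y = mkens (fun z : {z | R z y} => c R wf (sval z)).
  rewrite /c Fix_eq // => {}y g h gh; congr mkens.
  by apply: functional_extensionality_dep => -[z zy]; exact: gh.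
pose I := {R : Y -> Y -> Prop & (well_founded R * (Y -> Prop))%type}.
exists (V_of (mkens (fun i : I =>
  mkens (fun y : {y | (projT2 i).2 y} => c _ (projT2 i).1 (sval y))))).
move=> x t tt xt /(card_le_injP y0)[j [_ jI]]; rewrite elts_family.
pose R z y := exists b b', [/\ t b, t b', j b = z, j b' = y & elts b' b].
have accR b : t b -> Acc R (j b).
  elim/(well_founded_ind V_foundation): b => b IH tb; constructor=> z.
  move=> [b1 [b2 [tb1 tb2 <- /(jI _ _ tb2 tb) -> bb1]]]; exact: IH.
have wfR : well_founded R.
  move=> y; constructor=> z [b [b' [tb _ <- _ _]]]; exact: accR.
have collapse b : t b -> V_of (c R wfR (j b)) = b.
  elim/(well_founded_ind V_foundation): b => b IH tb.
  rewrite cE; apply: V_ext; rewrite elts_family; apply/seteqP; split=> z.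
    move=> [[y [b1 [b2 [tb1 tb2 jb1 /(jI _ _ tb2 tb) e bb1]]]] _ <-] /=.
    by rewrite -jb1; move: bb1; rewrite e => bb1; rewrite IH.
  move=> bz; have tz := tt _ tb _ bz.
  have Rz : R (j z) (j b) by exists z, b.
  by exists (exist (R^~ (j b)) _ Rz) => //=; exact: IH.
exists (existT _ R (wfR, fun y => exists2 b, elts x b & j b = y)) => //=.
apply: V_ext; rewrite elts_family; apply/seteqP; split=> z /=.
  by move=> [[y [b xb jb]] _ <-] /=; rewrite -jb collapse //; exact: xt.
move=> xz; have h : exists2 b, elts x b & j b = j z by exists z.
by exists (exist (fun y => exists2 b, elts x b & j b = y) _ h) => //=; apply: collapse; exact: xt.
Qed.

Lemma is_set_H theta : is_set (H theta).
Proof.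
have [D thD] := card_le_small_type theta.
have [d|nD] := pselect (inhabited D); last first.
  apply: (is_set_sub (x := theta)) => x /andP[_ /negP]; case.
  have -> : elts theta = set0; last exact: card_ge0.
  apply/seteqP; split=> // y ty.
  by move: thD => /card_leP[g]; case: nD; have [d _] := g (SigSub (mem_set ty)).
case: d => d; have [h hP] := transitive_le_bounded d.
apply: (is_set_sub (x := h)) => x /andP[xt _].
apply: (hP x _ (@trcl_trans x) (@trcl_sub x)); exact: card_le_trans xt thD.
Qed.

Lemma transitive_H theta : transitive_set (H theta).
Proof.
move=> x /andP[xt tx] y xy.
have yx : trcl y `<=` trcl x.
  by apply: trcl_min (@trcl_trans x) _; apply: trcl_trans; exact: trcl_sub.
rewrite /H /=; apply/andP; split.
  exact: card_le_trans (subset_card_le yx) xt.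
by apply: contra tx => /card_le_trans; apply; exact: subset_card_le.
Qed.

Lemma ordinal_mem a b : ordinal_V a -> elts a b -> ordinal_V b.
Proof.
move=> [ta la] ab; split=> [c bc d cd|c d bc bd]; last first.
  by apply: la; exact: ta ab _ _.
have ac := ta _ ab _ bc; have ad := ta _ ac _ cd.
case: (la _ _ ab ad) => [//|e|db]; first by move: cd; rewrite -e => /(elts_asym bc).
by have := elts_acyclic bc cd db.
Qed.

Lemma ordinal_total a b : ordinal_V a -> ordinal_V b ->
  [\/ elts b a, a = b | elts a b].
Proof.
elim/(well_founded_ind V_foundation): a b => a IHa b.
elim/(well_founded_ind V_foundation): b => b IHb oa ob.
have [ba|nba] := pselect (elts b a); first by constructor 1.
have [ab|nab] := pselect (elts a b); first by constructor 3.
constructor 2; apply: V_ext; apply/seteqP; split=> x.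
  move=> ax; case: (IHa x ax b (ordinal_mem oa ax) ob) => // [e|xb].
    by case: nab; rewrite -e.
  by case: nab; exact: oa.1 xb.
move=> bx; case: (IHb x bx oa (ordinal_mem ob bx)) => // [xa|e].
  by case: nba; exact: ob.1 xa.
by case: nba; rewrite e.
Qed.

(** Linearity comes for free, by [ordinal_total]. *)
Lemma ordinal_of_initial (x : V) :
  elts x `<=` ordinal_V -> transitive_set (elts x) -> ordinal_V x.
Proof.
move=> oP tP; split=> [|b c Pb Pc]; first exact: tP.
by case: (ordinal_total (oP _ Pb) (oP _ Pc)) => ?; [constructor 3|constructor 2|constructor 1].
Qed.

(** ** Hartogs numbers *)

Section Hartogs.
Variables (Y : Type) (k : V).
Hypothesis kE : elts k = [set a | ordinal_V a /\ elts a #<= [set: Y]].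

Lemma hartogs_ordinal : ordinal_V k.
Proof.
apply: ordinal_of_initial => [a|a]; rewrite kE => -[oa aY] // b ab.
split; first exact: ordinal_mem ab.
exact: card_le_trans (subset_card_le (oa.1 _ ab)) aY.
Qed.

(** Otherwise [k] would be one of its own elements. *)
Lemma hartogs_not_le : ~ (elts k #<= [set: Y]).
Proof.
move=> kY; apply: (@elts_irrefl k); rewrite {1}kE; split=> //.
exact: hartogs_ordinal.
Qed.

Lemma hartogs_compare T (B : set T) :
  elts k #<= B \/ exists2 a, elts k a & B #<= elts a.
Proof.
have [_ tot] := hartogs_ordinal.
have tot' a b : elts k a -> elts k b -> [\/ elts b a, a = b | elts a b].
  by move=> ka kb; case: (tot a b ka kb) => ?; [constructor 3|constructor 2|constructor 1].
have [kB|[a ka Ba]] := wf_compare B V_foundation tot'; first by left.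
right; exists a => //; apply: card_le_trans Ba _.
by apply: subset_card_le => y [].
Qed.

Lemma hartogs_ge : [set: Y] #<= elts k.
Proof.
have [/hartogs_not_le//|[a ka Ya]] := hartogs_compare [set: Y].
apply: card_le_trans Ya _; apply: subset_card_le; exact: hartogs_ordinal.1.
Qed.

(** If [k] does not embed into a cofinal subset [X], then [X] has size at most
    [Y], and so has [k], as the union of the successors of the members of [X]. *)
Lemma hartogs_regular : [set: nat] #<= [set: Y] ->
  [set: Y] `*` [set: Y] #<= [set: Y] -> regular_V k.
Proof.
move=> natY sqY; split.
- split; first exact: hartogs_ordinal.
  move=> a; rewrite {1}kE => -[_ aY]; apply/negP => ka.
  by apply: hartogs_not_le; exact: card_le_trans ka aY.
- exact: card_le_trans natY hartogs_ge.
- move=> X Xk cofX; have [//|[a]] := hartogs_compare X.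
  rewrite kE => -[_ aY] Xa; case: hartogs_not_le.
  apply: card_le_trans (subset_card_le (B := \bigcup_(b in X) ([set b] `|` elts b)) _) _.
    by move=> c /cofX[b Xb cb]; exists b.
  apply: card_le_bigcup => // [|b /Xk]; first exact: card_le_trans Xa aY.
  rewrite kE => -[_ bY]; apply: card_le_setU => //.
  by apply: countable_card_le => //; exact: countable1.
Qed.

End Hartogs.

Lemma hartogs_exists (Y : Type) (y0 : Y) :
  exists k, elts k = [set a | ordinal_V a /\ elts a #<= [set: Y]].
Proof.
have [h hP] := transitive_le_bounded y0; apply: (is_set_sub (x := h)) => a [oa aY].
apply: (hP a (elts a)) => //; exact: oa.1.
Qed.

(** [omega1] is the Hartogs number of [nat]. *)
Lemma is_set_omega1 : is_set omega1.
Proof. exact: (hartogs_exists 0). Qed.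

Lemma omega1_ordinal O : elts O = omega1 -> ordinal_V O.
Proof. by move=> OE; exact: (@hartogs_ordinal nat). Qed.

Lemma uncountable_omega1 : ~ countable omega1.
Proof. have [O OE] := is_set_omega1; rewrite -OE; exact: (@hartogs_not_le nat). Qed.

Lemma transitive_omega1 : transitive_set omega1.
Proof. have [O OE] := is_set_omega1; rewrite -OE; exact: (omega1_ordinal OE).1. Qed.

Lemma omega1_total a b : omega1 a -> omega1 b -> [\/ elts b a, a = b | elts a b].
Proof. by move=> [oa _] [ob _]; exact: ordinal_total. Qed.

Lemma nat_le_omega1 : [set: nat] #<= omega1.
Proof. have [O OE] := is_set_omega1; rewrite -OE; exact: (@hartogs_ge nat). Qed.

Lemma countable_succ a : countable (elts a) -> countable ([set a] `|` elts a).
Proof.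
move=> ca; apply: (@card_le_setU _ _ (card_lexx _) card_nat_setX) => //.
exact: countable1.
Qed.

Lemma omega1_unbounded b : omega1 b -> exists2 a, omega1 a & elts a b.
Proof.
move=> wb; apply: contrapT => nb; apply: uncountable_omega1.
apply: sub_countable (countable_succ wb.2); apply: subset_card_le => a wa.
case: (omega1_total wa wb) => [|->|ab]; [by right|by left|].
by case: nb; exists a.
Qed.

Lemma omega1_nonempty : omega1 !=set0.
Proof.
apply/set0P/eqP => w0; apply: uncountable_omega1; rewrite w0; exact: countable0.
Qed.

Definition lex_omega1_nat (p q : V * nat) :=
  elts q.1 p.1 \/ (p.1 = q.1 /\ p.2 < q.2)%N.

Lemma wf_lex_omega1_nat : well_founded lex_omega1_nat.
Proof.
suff acc a n : Acc lex_omega1_nat (a, n) by case=> a n; exact: acc.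
elim/(well_founded_ind V_foundation): a n => a IHa.
apply: (well_founded_ind lt_wf) => n IHn.
constructor=> -[b m] [/= /IHa//|/= [-> mn]]; apply: IHn; exact/ltP.
Qed.

(** In the lexicographic order the proper initial segments are countable, so
    [omega1] embeds into none of them. *)
Lemma omega1_setX_nat : omega1 `*` [set: nat] #<= omega1.
Proof.
have tot p q : (omega1 `*` [set: nat]) p -> (omega1 `*` [set: nat]) q ->
    [\/ lex_omega1_nat p q, p = q | lex_omega1_nat q p].
  move: p q => [a m] [b n] [/= wa _] [/= wb _]; rewrite /lex_omega1_nat /=.
  case: (omega1_total wa wb) => [?|->|?]; [by constructor 1; left| |by constructor 3; left].
  by case: (ltngtP m n) => [?|?|->]; [constructor 1; right|constructor 3; right|constructor 2].
have [//|[[a n] [/= [_ ca] _] le]] := wf_compare omega1 wf_lex_omega1_nat tot.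
case: uncountable_omega1; apply: card_le_trans le _.
apply: sub_countable (countableX (countable_succ ca) (countableP [set: nat])).
apply: subset_card_le => -[b m] [_ [/= ab|/= [-> _]]]; split=> //; by [right|left].
Qed.

(** A pair lies in the square of the successor of its larger coordinate, and this
    square is countable. *)
Lemma omega1_setX : omega1 `*` omega1 #<= omega1.
Proof.
apply: card_le_trans omega1_setX_nat.
pose S c := [set c] `|` elts c.
have : omega1 `*` omega1 `<=` \bigcup_(c in omega1) (S c `*` S c).
  move=> [a b] [/= wa wb]; case: (omega1_total wa wb) => [ab|<-|ba].
  - by exists b => //; split; [right|left].
  - by exists a => //; split; left.
  - by exists a => //; split; [left|right].
move=> /subset_card_le/card_le_trans; apply.
apply: card_le_bigcup_setX => c [_ cc].
by apply: countableX; exact: countable_succ.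
Qed.

(** ** Numerals *)

Lemma succ_exists (x : V) : is_set (elts x `|` [set x]).
Proof. by have [s sE] := is_set1 x; rewrite -sE; exact: is_setU. Qed.

Fixpoint numeral n : V :=
  if n is m.+1 then sval (cid (succ_exists (numeral m))) else sval (cid is_set0).

Lemma elts_numeral n : elts (numeral n) = [set x | exists2 m, (m < n)%N & x = numeral m].
Proof.
elim: n => [|n IH] /=; case: cid => x /= ->.
  by apply/seteqP; split=> // y [].
rewrite IH; apply/seteqP; split=> y.
  move=> [[m mn ->]|->]; first by exists m => //; exact: ltnW.
  by exists n.
move=> [m]; rewrite ltnS leq_eqVlt => /orP[/eqP->->|mn ->]; first by right.
by left; exists m.
Qed.

Lemma numeral_inj : injective numeral.
Proof.
suff lt m n : (m < n)%N -> numeral m <> numeral n.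
  by move=> m n e; case: (ltngtP m n) => // /lt; rewrite e.
move=> mn e; apply: (@elts_irrefl (numeral n)); rewrite -{2}e elts_numeral.
by exists m.
Qed.

Lemma omega_exists : exists w, ordinal_V w /\ elts w = range numeral.
Proof.
have [w wE] := is_set_range numeral; exists w; split=> //.
have tr : transitive_set (range numeral).
  by move=> _ [n _ <-] b; rewrite elts_numeral => -[m _ ->]; exists m.
split; rewrite wE; first exact: tr.
move=> b c [m _ <-] [n _ <-].
rewrite !elts_numeral; case: (ltngtP m n) => [mn|nm|->].
- by constructor 3; exists m.
- by constructor 1; exists n.
- by constructor 2.
Qed.

(** * Clubs and stationary sets *)

Section ClubTransport.
Variables (U : Type) (B : set U).
Hypotheses (Binf : [set: nat] #<= B) (Bsq : B `*` B #<= B).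

Lemma stationaryS T (A : set T) (S S' : set (set T)) :
  S' `<=` subsets_le B A -> S `<=` S' -> stationary B A S -> stationary B A S'.
Proof.
move=> S'A SS' [_ st]; split=> // C /st[X [CX SX]].
by exists X; split=> //; exact: SS'.
Qed.

(** Images, preimages and traces are all instances: the [X] with [phi X] in a
    club form a club, by the lifting hypothesis for unboundedness. *)
Lemma stationary_projection T T' (A : set T) (A' : set T') (phi : set T -> set T')
    (S : set (set T)) :
  (forall (D : set V) F, phi (\bigcup_(i in D) F i) = \bigcup_(i in D) phi (F i)) ->
  {homo phi : X Y / X `<=` Y} ->
  (forall X, subsets_le B A X -> subsets_le B A' (phi X)) ->
  (forall X Y, subsets_le B A X -> subsets_le B A' Y -> phi X `<=` Y ->
     exists Z, [/\ subsets_le B A Z, X `<=` Z & phi Z = Y]) ->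
  stationary B A S -> stationary B A' (phi @` S).
Proof.
move=> phiU phiS phiA lift [SA st]; split=> [_ [X /SA AX <-]|C [CA Ccl Cub]].
  exact: phiA.
have [|X [[_ CX] SX]] := st [set X | subsets_le B A X /\ C (phi X)]; last first.
  by exists (phi X); split=> //; exists X.
split=> [X []//|a s oa a0 aB Cs incr|X AX].
  split; last first.
    rewrite phiU; apply: Ccl => // i; first by move=> /Cs[].
    by move=> j ai aj ji; apply: phiS; exact: incr.
  split; last by apply: card_le_bigcup => // i /Cs[[]].
  by move=> x [i /Cs[[sA _] _] /sA].
have [Y CY phiXY] := Cub _ (phiA _ AX).
have [Z [AZ XZ phiZ]] := lift _ _ AX (CA _ CY) phiXY.
by exists Z => //; split=> //; rewrite phiZ.
Qed.

Lemma stationary_image T T' (f : T -> T') (S : set (set T)) : injective f ->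
  stationary B [set: T] S -> stationary B (range f) (image^~ f @` S).
Proof.
move=> fI; apply: stationary_projection.
- by move=> D F; rewrite image_bigcup.
- by move=> X Y; exact: image_subset.
- move=> X [_ XB]; split; first exact: image_subset.
  exact: card_le_trans (card_image_le _ _) XB.
- move=> X Y [_ XB] [Yf YB] XY; exists (f @^-1` Y); split.
  + split=> //; apply: card_le_trans YB.
    by apply: (card_le_inj (f := f)) => // x y _ _; exact: fI.
  + by move=> x Xx; apply: XY; exists x.
  + apply/seteqP; split=> [_ [x Yx <-]//|y Yy].
    by have [x _ fx] := Yf _ Yy; exists x => //; rewrite /preimage /= fx.
Qed.

Lemma stationary_preimage T T' (f : T -> T') (S : set (set T')) : injective f ->
  stationary B (range f) S -> stationary B [set: T] (preimage f @` S).
Proof.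
move=> fI; apply: stationary_projection.
- by move=> D F; rewrite preimage_bigcup.
- by move=> X Y; exact: preimage_subset.
- move=> X [_ XB]; split=> //; apply: card_le_trans XB.
  by apply: (card_le_inj (f := f)) => // x y _ _; exact: fI.
- move=> X Y [Xf XB] [_ YB] XY; exists (f @` Y); split.
  + split; first exact: image_subset.
    exact: card_le_trans (card_image_le _ _) YB.
  + move=> y Xy; have [x _ fx] := Xf _ Xy; exists x => //.
    by apply: XY; rewrite /preimage /= fx.
  + by apply/seteqP; split=> [x [y Yy /fI<-]//|x Yx]; exists x.
Qed.

Lemma stationary_trace T (A a : set T) (S : set (set T)) :
  stationary B A S -> stationary B (A `&` a) ((fun X => X `&` a) @` S).
Proof.
apply: stationary_projection.
- by move=> D F; rewrite setI_bigcupl.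
- by move=> X Y; exact: setSI.
- move=> X [XA XB]; split; first exact: setSI.
  exact: card_le_trans (subset_card_le (@subIsetl _ _ _)) XB.
- move=> X Y [XA XB] [YA YB] XY; exists (X `|` Y); split.
  + split; last exact: card_le_setU.
    by move=> x [/XA|/YA[]].
  + by move=> x; left.
  + apply/seteqP; split=> x.
      by move=> [[Xx|//] ax]; apply: XY.
    by move=> Yx; split; [right|exact: (YA _ Yx).2].
Qed.

(** Closure is about chains indexed by ordinals; here the chain is reindexed by
    the numerals. *)
Lemma closed_in_nat T (C : set (set T)) (t : nat -> set T) :
  closed_in B C -> (forall n, C (t n)) -> (forall n, t n `<=` t n.+1) ->
  C (\bigcup_n t n).
Proof.
move=> Ccl Ct incr; have [w [ow wE]] := omega_exists.
have mono m n : (m <= n)%N -> t m `<=` t n.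
  elim: n => [|n IH]; first by rewrite leqn0 => /eqP->.
  rewrite leq_eqVlt => /orP[/eqP->//|/IH mn]; exact: subset_trans mn (incr n).
pose s i := \bigcup_(n in [set n | i = numeral n]) t n.
have sE n : s (numeral n) = t n.
  by apply/seteqP; split=> x; [case=> m /numeral_inj->|exists n].
have -> : \bigcup_n t n = \bigcup_(i in elts w) s i.
  rewrite wE bigcup_image; apply: eq_bigcupr => n _; by rewrite sE.
apply: Ccl => //; rewrite wE.
- by exists (numeral 0), 0.
- exact: card_le_trans (card_image_le _ _) Binf.
- by move=> _ [n _ <-]; rewrite sE.
- move=> _ _ [m _ <-] [n _ <-]; rewrite elts_numeral => -[k kn /numeral_inj].
  by move=> e; rewrite !sE; apply: mono; rewrite ltnW // e.
Qed.

(** A finite subset of a directed union lies in one of the sets; finite subsets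
    are given as lists. *)
Lemma directed_seq (T : eqType) (I : Type) (P : set I) (F : I -> set T) (s : seq T) :
  P !=set0 ->
  (forall i j, P i -> P j -> exists k, [/\ P k, F i `<=` F k & F j `<=` F k]) ->
  (forall x, x \in s -> exists2 i, P i & F i x) ->
  exists2 k, P k & forall x, x \in s -> F k x.
Proof.
move=> [i0 Pi0] dir; elim: s => [|x s IH] sF; first by exists i0.
have [|i Pi Fi] := IH; first by move=> y ys; apply: sF; rewrite inE ys orbT.
have [j Pj Fj] := sF x (mem_head _ _).
have [k [Pk ik jk]] := dir i j Pi Pj; exists k => // y.
by rewrite inE => /orP[/eqP->|/Fi]; [exact: jk|exact: ik].
Qed.

(** Lists rather than finite sets, so that [G] can depend on the order of its
    arguments, as the functions of a structure do. *)
Definition closed_under (G : seq V -> set V) (W : set V) :=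
  forall s : seq V, (forall x, x \in s -> W x) -> G s `<=` W.

Lemma club_closed_under (G : seq V -> set V) (A : set V) :
  (forall s : seq V, (forall x, x \in s -> A x) -> subsets_le B A (G s)) ->
  club B A [set W | subsets_le B A W /\ closed_under G W].
Proof.
move=> GA; split=> [W []//|a s oa a0 aB Cs incr|X [XA XB]].
  split.
    split; last by apply: card_le_bigcup => // i /Cs[[]].
    by move=> x [i /Cs[[sA _] _] /sA].
  move=> l ls.
  have [|i ai li] := directed_seq a0 _ ls; last first.
    by move=> x Gx; exists i => //; exact: (Cs i ai).2 l li x Gx.
  move=> i j ai aj; case: (oa.2 i j ai aj) => [ij|<-|ji].
  - by exists i; split=> //; exact: incr.
  - by exists i; split.
  - by exists j; split=> //; exact: incr.
(* For unboundedness, close off in omega steps. *)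
pose cl Y := Y `|` \bigcup_(s in [set s : seq V | forall x, x \in s -> Y x]) G s.
pose W n := iter n cl X.
have WAB n : subsets_le B A (W n).
  elim: n => [//|n [IHA IHB]]; split=> [x [/IHA//|[s /= sW Gx]]|].
    have sA x' : x' \in s -> A x' by move=> /sW/IHA.
    exact: (GA _ sA).1.
  apply: card_le_setU => //; apply: card_le_bigcup => //; first exact: card_le_seqs.
  move=> s /= sW.
  have sA x' : x' \in s -> A x' by move=> /sW/IHA.
  exact: (GA _ sA).2.
have Wincr n : W n `<=` W n.+1 by move=> x; left.
have Wmono m n : (m <= n)%N -> W m `<=` W n.
  elim: n => [|n IH]; first by rewrite leqn0 => /eqP->.
  rewrite leq_eqVlt => /orP[/eqP->//|/IH mn]; exact: subset_trans mn (Wincr n).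
exists (\bigcup_n W n); last by move=> x Xx; exists 0.
split; first split.
- by move=> x [n _ /(WAB n).1].
- by apply: card_le_bigcup => // n _; exact: (WAB n).2.
- move=> s sW; have [||n _ sn] := directed_seq _ _ sW.
  + by exists 0.
  + move=> m n _ _; exists (maxn m n).
    by split=> //; apply: Wmono; rewrite ?leq_maxl ?leq_maxr.
  + by move=> x Gx; exists n.+1 => //; right; exists s.
Qed.

(** Choose [F s] in the club above [s] and above the sets already chosen for the
    proper subsets [s `\ x]; [Fn n] is this choice for sets with [n] elements. *)
Lemma club_monotone_choice (A : set V) (D : set (set V)) : club B A D ->
  exists F : {fset V} -> set V,
    (forall s : {fset V}, [set` s] `<=` A -> D (F s) /\ [set` s] `<=` F s) /\
    (forall s t : {fset V}, [set` t] `<=` A -> (s `<=` t)%fset -> F s `<=` F t).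
Proof.
move=> [DA Dcl Dub].
have : forall X, exists Y, subsets_le B A X -> D Y /\ X `<=` Y.
  move=> X; have [AX|nAX] := pselect (subsets_le B A X).
    by have [Y DY XY] := Dub X AX; exists Y.
  by exists X => /nAX.
move=> /choice[f fP].
pose Fn := fix Fn n (s : {fset V}) : set V := f ([set` s] `|`
  (if n is m.+1 then \bigcup_(x in [set` s]) Fn m (s `\ x)%fset else set0)).
have FnA n s : [set` s] `<=` A -> D (Fn n s) /\ [set` s] `<=` Fn n s.
  elim: n s => [|n IH] s sA.
    rewrite /= setU0; apply: fP; split=> //.
    exact: countable_card_le (countable_fset _).
  have Fs x : [set` s] x -> D (Fn n (s `\ x)%fset).
    move=> sx; apply: (IH _ _).1 => y /=; rewrite !inE => /andP[_]; exact: sA.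
  have [|DF sF] := fP ([set` s] `|` \bigcup_(x in [set` s]) Fn n (s `\ x)%fset).
    split; first by move=> y [/sA//|[x /Fs/DA[h _] /h]].
    have cs : [set` s] #<= B by apply: countable_card_le => //; exact: countable_fset.
    apply: card_le_setU => //; apply: card_le_bigcup => // x /Fs/DA[_ //].
  by split=> // x sx; apply: sF; left.
exists (fun s => Fn #|` s| s); split=> [s|s t]; first exact: FnA.
have [n] := ubnP #|` t|; elim: n t => // n IH t tn tA st.
have [-> //|neq] := eqVneq s t.
have /fsubsetPn[x xt xs] : ~~ (t `<=` s)%fset.
  by apply: contra neq => ts; rewrite eqEfsubset st.
have tx : [set` (t `\ x)%fset] `<=` A.
  by move=> y /=; rewrite !inE => /andP[_]; exact: tA.
have ct : #|` t| = #|` (t `\ x)%fset|.+1 by rewrite (cardfsD1 x) xt.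
apply: (@subset_trans _ (Fn #|` (t `\ x)%fset| (t `\ x)%fset)).
  apply: IH => //; first by rewrite -ltnS -ct.
  by rewrite fsubsetD1 st xs.
move=> y Fy; rewrite ct /=.
set X := (X in f X); have [|_ Xf] := fP X; last by apply: Xf; right; exists x.
have cs : [set` t] #<= B by apply: countable_card_le => //; exact: countable_fset.
have Ft z : [set` t] z -> D (Fn #|` (t `\ x)%fset| (t `\ z)%fset).
  move=> tz; apply: (FnA _ _ _).1 => w /=; rewrite !inE => /andP[_]; exact: tA.
split; first by move=> z [/tA//|[w /Ft/DA[h _] /h]].
by apply: card_le_setU => //; apply: card_le_bigcup => // z /Ft/DA[].
Qed.

(** For monotone [F] this is a directed union.  Below it is shown to stay in the
    club for countable [X] first, and then for [X] of size [omega1]; as clubs are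
    closed under unions of chains only, [X] is written as an increasing union
    each time. *)
Definition fset_hull (F : {fset V} -> set V) (X : set V) :=
  \bigcup_(s in [set s : {fset V} | [set` s] `<=` X]) F s.

Lemma fset_hull_countable (A : set V) (D : set (set V)) (F : {fset V} -> set V) X :
  closed_in B D ->
  (forall s : {fset V}, [set` s] `<=` A -> D (F s)) ->
  (forall s t : {fset V}, [set` t] `<=` A -> (s `<=` t)%fset -> F s `<=` F t) ->
  X `<=` A -> countable X -> D (fset_hull F X).
Proof.
move=> Dcl FD Fmono XA cX; have [g gX] := card_le_surj (numeral 0) cX.
pose s n := [fset x in [seq g i | i <- iota 0 n] | `[< X x >]]%fset.
have sE n x : x \in s n <-> X x /\ exists2 i, (i < n)%N & x = g i.
  rewrite !inE; split.
    move=> /andP[/mapP[i + ->] /asboolP Xg]; rewrite mem_iota => /andP[_ ?].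
    by split=> //; exists i.
  move=> [Xx [i ni xE]]; apply/andP; split; last exact/asboolP.
  by apply/mapP; exists i => //; rewrite mem_iota.
have sX n : [set` s n] `<=` X by move=> x /= /sE[].
have smono m n : (m <= n)%N -> (s m `<=` s n)%fset.
  move=> mn; apply/fsubsetP => x /sE[Xx [i im xE]]; apply/sE; split=> //.
  by exists i => //; exact: leq_trans mn.
have -> : fset_hull F X = \bigcup_n F (s n).
  apply/seteqP; split=> x; last by move=> [n _ Fx]; exists (s n) => //; exact: sX.
  move=> [r /= rX Fx].
  have [|||n _ rn] := @directed_seq _ nat setT (fun n => [set` s n]) r.
  - by exists 0.
  - move=> m n _ _; exists (maxn m n); split=> // y; apply/fsubsetP; apply: smono.
      exact: leq_maxl.
    exact: leq_maxr.
  - move=> y /rX Xy; have [i _ gi] := gX y Xy; exists i.+1 => //=.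
    by apply/sE; split=> //; exists i.
  - exists n => //; apply: (Fmono r) Fx; last by apply/fsubsetP => y /rn.
    exact: subset_trans (sX n) XA.
apply: closed_in_nat => // n; first by apply: FD; exact: subset_trans (sX n) XA.
by apply: Fmono; [exact: subset_trans (sX _) XA|exact: smono].
Qed.

End ClubTransport.

(** For an enumeration [g] of [X], the sets [X `&` g @` elts a] with [a] in
    [omega1] are countable and increase to [X]. *)
Lemma fset_hull_omega1 (A : set V) (D : set (set V)) (F : {fset V} -> set V) X :
  closed_in omega1 D ->
  (forall s : {fset V}, [set` s] `<=` A -> D (F s)) ->
  (forall s t : {fset V}, [set` t] `<=` A -> (s `<=` t)%fset -> F s `<=` F t) ->
  X `<=` A -> X #<= omega1 -> D (fset_hull F X).
Proof.
move=> Dcl FD Fmono XA wX; have [g gX] := card_le_surj (numeral 0) wX.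
have [O OE] := is_set_omega1; have oO := omega1_ordinal OE.
pose S a := X `&` g @` elts a.
have Smono a b : omega1 a -> elts a b -> S b `<=` S a.
  move=> [oa _] ab x [Xx [c bc gc]]; split=> //; exists c => //.
  exact: oa.1 ab _ bc.
have -> : fset_hull F X = \bigcup_(a in elts O) fset_hull F (S a).
  apply/seteqP; split=> x; last first.
    by move=> [a _ [s /= sS Fx]]; exists s => // y /sS[].
  move=> [s /= sX Fx]; rewrite OE.
  have [|||a wa sa] := @directed_seq _ V omega1 S s.
  - exact: omega1_nonempty.
  - move=> a b wa wb; case: (omega1_total wa wb) => [ba|<-|ab].
    + by exists b; split=> //; exact: Smono.
    + by exists a; split.
    + by exists a; split=> //; exact: Smono.
  - move=> y /sX Xy; have [b wb gb] := gX y Xy.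
    have [a wa ab] := omega1_unbounded wb; exists a => //.
    by split=> //; exists b.
  - by exists a => //; exists s.
apply: (Dcl) => //; rewrite OE.
- exact: omega1_nonempty.
- exact: card_lexx.
- move=> a [_ ca]; apply: (fset_hull_countable nat_le_omega1 (A := A)) => //.
  + by move=> x [/XA].
  + apply: sub_countable ca; apply: card_le_trans (card_image_le g _).
    by apply: subset_card_le => x [].
- move=> a b wa wb ba x [s /= sb Fx]; exists s => //=.
  by move=> y /sb; apply: Smono.
Qed.

(** The upward projection theorem.  Given a club [D] of countable subsets of
    [A] and [F] as in [club_monotone_choice], the countable [X `<=` a] closed
    under [s |-> F s `&` a] form a club, so one of them is in [S]; then
    [fset_hull F X] is in [D], and its trace on [a] is [X]. *)
Lemma stationary_lift (A a : set V) (S : set (set V)) : a `<=` A ->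
  stationary_ctbl a S ->
  stationary_ctbl A [set Z | ctbl_subsets A Z /\ S (Z `&` a)].
Proof.
move=> aA [Sa st]; split=> [Z []//|D clubD].
have sqN := card_nat_setX; have lexx := card_lexx [set: nat].
have [F [FD Fmono]] := club_monotone_choice lexx sqN clubD.
case: clubD => DA Dcl Dub.
pose fs (s : seq V) : {fset V} := [fset x in s]%fset.
pose G (s : seq V) := F (fs s) `&` a.
have [|X [[[Xa cX] GX] SX]] := st _ (club_closed_under lexx sqN (G := G) (A := a) _).
  move=> s sa; split; first by move=> x [].
  have [|/DA[_ cF] _] := FD (fs s).
    by move=> x /=; rewrite inE => /sa/aA.
  by apply: sub_countable cF; apply: subset_card_le => x [].
have DX : D (fset_hull F X).
  apply: (fset_hull_countable lexx (A := A)) => //; last exact: subset_trans Xa aA.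
  by move=> s /FD[].
exists (fset_hull F X); split=> //; split; first exact: DA.
suff -> : fset_hull F X `&` a = X by [].
apply/seteqP; split=> x.
  move=> [[s /= sX Fx] ax]; apply: (GX (enum_fset s)) => //.
  have sE : fs (enum_fset s) = s by apply/fsetP => y; rewrite inE.
  by rewrite /G sE.
move=> Xx; split; last exact: Xa.
have xX : [set` [fset x]%fset] `<=` X by move=> y /=; rewrite inE => /eqP->.
exists [fset x]%fset => //.
have [|_] := FD [fset x]%fset; first by move=> y /xX/Xa/aA.
by apply; rewrite /= inE.
Qed.

(** * From formulas to stationary sets *)

(** The symbol [(k, n)] stands for the [k]-th function with [n] arguments. *)
Definition mem_sig : signature :=
  @Signature (nat * nat)%type snd unit (fun=> 2).

Definition f_in (x y : nat) : formula mem_sig :=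
  @FRel mem_sig tt (fun i : 'I_2 => @Var mem_sig (if i == ord0 then x else y)).

Definition f_all (x : nat) (p : formula mem_sig) := FNot (FEx x (FNot p)).
Definition f_imp (p q : formula mem_sig) := FNot (FAnd p (FNot q)).

(** With the variable 1 for [o]: some element of [o] is not in [Z]. *)
Definition f_escape : formula mem_sig :=
  FStat 0 (FEx 0 (FAnd (f_in 0 1) (FNot (@FMem mem_sig 0 0)))).

(** With the variables 1 for [S] and 2 for [a]: the set [Z `&` a] is, as far as
    the structure can see, an element of [S]. *)
Definition f_trace : formula mem_sig :=
  FStat 0 (FEx 0 (FAnd (f_in 0 1)
    (f_all 3 (FAnd (f_imp (f_in 3 0) (FAnd (@FMem mem_sig 0 3) (f_in 3 2)))
                   (f_imp (FAnd (@FMem mem_sig 0 3) (f_in 3 2)) (f_in 3 0)))))).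

(** [traces] and [escapes] collect the [Z] that satisfy the bodies of [f_trace]
    and [f_escape] in the structure with universe [A]. *)
Definition traces (A : set V) (a S : V) : set (set V) :=
  [set Z | ctbl_subsets A Z /\ exists s, [/\ A s, elts S s &
    forall y, A y -> (elts s y <-> Z y /\ elts a y)]].

Definition escapes (A : set V) (o : V) : set (set V) :=
  [set Z | ctbl_subsets A Z /\ exists x, [/\ A x, elts o x & ~ Z x]].

(** [j] identifies the universe with a subset of [V]; this serves both a structure
    on [elts A] and its restrictions, whose universes are subtypes of subtypes. *)
Section Semantics.
Variables (T : Type) (j : T -> V) (M : structure mem_sig T).
Hypothesis jI : injective j.
Hypothesis inM : forall a : 'I_2 -> T,
  rint M (r := tt) a <-> elts (j (a ord_max)) (j (a ord0)).

Lemma ctbl_image X : ctbl_subsets [set: T] X <-> ctbl_subsets (range j) (j @` X).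
Proof.
split=> -[_ cX]; split=> //; first exact: image_subset.
  exact: card_le_trans (card_image_le _ _) cX.
apply: card_le_trans cX; apply: (card_le_inj (f := j)) => [x Xx|x y _ _ /jI//].
by exists x.
Qed.

Lemma stat_transport (S : set (set T)) (S' : set (set V)) :
  S `<=` ctbl_subsets [set: T] -> S' `<=` ctbl_subsets (range j) ->
  (forall X, ctbl_subsets [set: T] X -> S X <-> S' (j @` X)) ->
  stationary_ctbl [set: T] S <-> stationary_ctbl (range j) S'.
Proof.
move=> ST S'T SS'; split=> st.
  apply: stationaryS _ _ (stationary_image card_nat_setX jI st) => //.
  by move=> _ [X SX <-]; apply/SS' => //; exact: ST.
apply: stationaryS _ _ (stationary_preimage card_nat_setX jI st) => //.
move=> _ [X S'X <-].
have jX : j @` (j @^-1` X) = X.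
  apply/seteqP; split; first exact: image_preimage_subset.
  by move=> x Xx; have [y _ yx] := (S'T _ S'X).1 _ Xx; exists y; rewrite //= yx.
have cX : ctbl_subsets [set: T] (j @^-1` X) by apply/ctbl_image; rewrite jX; exact: S'T.
by apply/(SS' _ cX); rewrite jX.
Qed.

Lemma sat_escape v w :
  sat M v w f_escape <-> stationary_ctbl (range j) (escapes (range j) (j (v 1))).
Proof.
apply: stat_transport => [X []|X []|X cX] //.
split=> [[_ [x [/inM ox nx]]]|[_ [_ [[x _ <-] ox nx]]]].
  split; first exact/ctbl_image.
  by exists (j x); split=> //; rewrite image_inj.
split=> //; exists x; split; first exact/inM.
by rewrite image_inj in nx.
Qed.

Lemma sat_trace v w :
  sat M v w f_trace <->
  stationary_ctbl (range j) (traces (range j) (j (v 2)) (j (v 1))).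
Proof.
apply: stat_transport => [X []|X []|X cX] //.
split=> [[_ [x [/inM Sx h]]]|[_ [_ [[x _ <-] Sx h]]]].
  split; first exact/ctbl_image.
  exists (j x); split=> // _ [y _ <-]; rewrite image_inj //.
  have {}h : (elts (j x) (j y) -> X y /\ elts (j (v 2)) (j y)) /\
             (X y -> elts (j (v 2)) (j y) -> elts (j x) (j y)).
    apply: contrapT => nh; apply: h; exists y => -[h1 h2]; apply: nh.
    split=> [xy|Xy ay]; apply: contrapT => n.
      by apply: h1; split; [exact/inM|move=> [Xy /inM ay]; exact: n].
    by apply: h2; split; [split=> //; exact/inM|move=> /inM].
  by split=> [/h.1//|[]]; exact: h.2.
split=> //; exists x; split; first exact/inM.
move=> [y]; apply; have := h (j y) (imageT j y); rewrite image_inj // => hy.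
split=> -[].
  move=> /inM xy; apply; have [Xy ay] := hy.1 xy.
  by split=> //; exact/inM.
by move=> [Xy /inM ay]; apply; apply/inM; exact/hy.
Qed.

End Semantics.

Lemma free2_escape Z : ~~ free2 f_escape Z.
Proof. by case: Z. Qed.

Lemma free2_trace Z : ~~ free2 f_trace Z.
Proof. by case: Z. Qed.

Lemma Pi11_escape : Pi11 f_escape.
Proof. exact/Pi11_stat/Pi11_base. Qed.

Lemma Pi11_trace : Pi11 f_trace.
Proof. exact/Pi11_stat/Pi11_base. Qed.

Lemma range_val_set T (A : set T) : range (val : A -> T) = A.
Proof.
by apply/seteqP; split=> [_ [[x /= /set_mem Ax] _ <-]|x Ax] //; exists (SigSub (mem_set Ax)).
Qed.

Lemma range_val_val T (A : set T) (W : set A) :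
  range (fun x : W => val (val x)) = val @` W.
Proof. by rewrite -[in RHS](range_val_set W) -image_comp. Qed.

(** The reflection property in the form in which it is used: all of it about
    subsets of [V], for the structure with membership and enumerations of the
    countable sets [G s] as functions of [s]. *)
Lemma Pi11_LST_reflect : Pi11_LST -> forall (A : V) (G : seq V -> set V),
  elts A !=set0 -> (forall s, countable (G s)) ->
  exists W : set V, [/\ W `<=` elts A, W #<= omega1,
    forall s : seq V, (forall x, x \in s -> W x) -> G s `&` elts A `<=` W,
    forall o, W o -> stationary_ctbl (elts A) (escapes (elts A) o) ->
      stationary_ctbl W (escapes W o) &
    forall a S, W a -> W S -> stationary_ctbl (elts A) (traces (elts A) a S) ->
      stationary_ctbl W (traces W a S)].
Proof.
move=> LST A G [x0 Ax0] cG.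
pose T : Type := elts A; pose t0 : elts A := SigSub (mem_set Ax0).
have /choice[g gG] : forall s, exists g : nat -> V, G s `<=` range g.
  by move=> s; exact: card_le_surj x0 (cG s).
pose op k (l : seq (elts A)) : elts A := insubd t0 (g [seq val x | x <- l] k).
pose M : structure mem_sig (elts A) := @Structure mem_sig (elts A) (inhabits t0)
  (fun (f : nat * nat) (a : 'I_f.2 -> elts A) => op f.1 [seq a i | i <- enum 'I_f.2])
  (fun _ (a : 'I_2 -> elts A) => elts (val (a ord_max)) (val (a ord0))).
have [W [hW [cW WP]]] := LST mem_sig A M.
exists (val @` W).
have valI : injective (val : elts A -> V) by exact: val_inj.
have vvI : injective (fun x : W => val (val x)) by move=> x y /val_inj/val_inj.
have WV x : (val @` W) x -> exists2 y : W, val (val y) = x & True.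
  by move=> [y Wy <-]; exists (SigSub (mem_set Wy)).
split.
- by move=> _ [[x /= /set_mem Ax] _ <-].
- exact: card_le_trans (card_image_le _ _) cW.
- move=> s sW x [Gx Ax].
  have [k _ gk] := gG _ _ Gx.
  have : exists l : seq (elts A), s = [seq val x | x <- l] /\ forall y, y \in l -> W y.
    elim: s sW {Gx gk} => [|y s IH] sW; first by exists [::].
    have [|l [-> lW]] := IH; first by move=> z zs; apply: sW; rewrite inE zs orbT.
    have [z Wz <-] := sW y (mem_head _ _); exists (z :: l); split=> // u.
    by rewrite inE => /orP[/eqP->//|/lW].
  move=> [l [sE lW]].
  have := @sub_closed _ _ _ _ hW (k, size l) (tnth (in_tuple l)) _.
  rewrite /= map_tnth_enum /= /op -sE gk => h.
  exists (insubd t0 x); first by apply: h => i; apply: lW; exact: mem_tnth.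
  by rewrite insubdK //; exact: mem_set.
- move=> o [y Wy <-] st.
  have := WP f_escape Pi11_escape free2_escape (fun=> SigSub (mem_set Wy)).
  rewrite (sat_escape valI) // (sat_escape vvI) // range_val_set range_val_val.
  exact.
- move=> a S [y Wy <-] [z Wz <-] st.
  have := WP f_trace Pi11_trace free2_trace
    (fun n => if n == 2 then SigSub (mem_set Wy) else SigSub (mem_set Wz)).
  rewrite (sat_trace valI) // (sat_trace vvI) // range_val_set range_val_val.
  exact.
Qed.

Lemma stationary_ctbl_subsets T (A : set T) : stationary_ctbl A (ctbl_subsets A).
Proof.
split=> // C [CA _ Cub]; have [|Y CY _] := Cub set0.
  by split=> //; exact: countable0.
by exists Y; split=> //; exact: CA.
Qed.

Lemma omega1_H (theta O : V) : regular_V theta -> elts O = omega1 -> elts theta O ->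
  H theta O /\ omega1 `<=` H theta.
Proof.
move=> [[otheta ctheta] _ _] OE tO.
suff HO : H theta O by split=> //; rewrite -OE; exact: transitive_H.
have trO : trcl O `<=` elts O.
  by apply: trcl_min => //; rewrite OE; exact: transitive_omega1.
apply/andP; split.
  apply: subset_card_le; apply: subset_trans trO _; exact: otheta.1.
apply: contra (ctheta O tO) => /card_le_trans; apply; exact: subset_card_le.
Qed.

(** The values of [G] serve three ends: [O] puts [omega1] into [W]; the elements
    of countable [x] put countable elements of [W] inside [W]; and [e (fs t) x],
    where [e s] enumerates [F s] along [omega1], makes [W] closed under [F], so
    that [W = fset_hull F W] is in the given club. *)
Lemma LST_DRP : Pi11_LST -> DRP_internal.
Proof.
move=> LST; have [O OE] := is_set_omega1.
exists O; split=> [|theta rtheta thO]; first exact: omega1_ordinal OE.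
have [HO wH] := omega1_H rtheta OE thO.
have [A AE] := is_set_H theta; have tH := @transitive_H theta.
split=> [W []//|C clubC].
have [F [FC Fmono]] := club_monotone_choice nat_le_omega1 omega1_setX clubC.
case: (clubC) => CH Ccl _.
pose fs (s : seq V) : {fset V} := [fset x in s]%fset.
have : forall s, exists e : V -> V, [set` s] `<=` H theta -> F s `<=` e @` omega1.
  move=> s; have [/FC[/CH[_ cF] _]|ns] := pselect ([set` s] `<=` H theta); last first.
    by exists id => /ns.
  by have [e eP] := card_le_surj O cF; exists e.
move=> /choice[e eF].
pose G (s : seq V) : set V := if s is x :: t then
  [set O; e (fs t) x] `|` [set y | countable (elts x) /\ elts x y] else [set O].
have cG s : countable (G s).
  case: s => [|x t]; first exact: countable1.
  apply: (@card_le_setU _ _ (card_lexx _) card_nat_setX).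
    exact: finite_set_countable (finite_set2 _ _).
  have [cx|ncx] := pselect (countable (elts x)).
    by apply: sub_countable cx; apply: subset_card_le => y [].
  by apply: sub_countable (countable0 V); apply: subset_card_le => y [/ncx].
have [|W [WA cW GW Wesc Wtr]] := Pi11_LST_reflect LST (A := A) _ cG.
  by rewrite AE; exists O.
rewrite AE in WA GW Wesc Wtr.
have WO : W O by apply: (GW [::]).
have ctblW x : W x -> countable (elts x) -> elts x `<=` W.
  move=> Wx cx y xy; apply: (GW [:: x]) => [z|]; first by rewrite inE => /eqP->.
  by split; [right|exact: tH (WA _ Wx) _ xy].
(* Otherwise the countable sets above W `&` omega1 form a club, and none of
   them leaves out an element of omega1 that W can see. *)
have uW : ~ countable (W `&` omega1).
  move=> cWO.
  have /Wesc : stationary_ctbl (H theta) (escapes (H theta) O).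
    apply: stationaryS (stationary_ctbl_subsets _) => [X []//|X cX]; split=> //.
    apply: contrapT => nX; apply: uncountable_omega1; apply: sub_countable cX.2.
    apply: subset_card_le => x wx; apply: contrapT => nXx; apply: nX; exists x.
    by rewrite OE; split=> //; exact: wH.
  move=> /(_ WO) [_ st].
  have [|X [[_ GX] [_ [x [Wx Ox nXx]]]]] := st _ (club_closed_under (card_lexx _)
      card_nat_setX (G := fun=> W `&` omega1) (A := W) _).
    by move=> s _; split=> // x [].
  by apply: nXx; apply: (GX [::]) => //; rewrite -OE.
have wW : omega1 `<=` W.
  move=> b wb; apply: contrapT => nWb; apply: uW.
  apply: sub_countable (countable_succ wb.2); apply: subset_card_le => a [Wa wa].
  case: (omega1_total wa wb) => [|->|ab]; [by right|by left|].
  by case: nWb; exact: ctblW Wa wa.2 _ ab.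
have FW (s : {fset V}) : [set` s] `<=` W -> F s `<=` W.
  move=> sW x Fx; have sH : [set` s] `<=` H theta by exact: subset_trans sW WA.
  have [a wa ax] := eF s sH x Fx.
  have sE : fs (enum_fset s) = s by apply/fsetP => y; rewrite inE.
  apply: (GW (a :: enum_fset s)).
    by move=> y; rewrite inE => /orP[/eqP->|]; [exact: wW|exact: sW].
  split; last exact: (CH _ (FC _ sH).1).1 Fx.
  by left; right; rewrite sE ax.
have CW : C W.
  suff -> : W = fset_hull F W.
    by apply: (fset_hull_omega1 (A := H theta)) Fmono _ _ => // s /FC[].
  apply/seteqP; split=> x; last by move=> [s /FW]; apply.
  move=> Wx; have xW : [set` [fset x]%fset] `<=` W by move=> y /=; rewrite inE => /eqP->.
  exists [fset x]%fset => //.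
  have [|_] := FC [fset x]%fset; first by move=> y /xW/WA.
  by apply; rewrite /= inE.
exists W; split=> //; split=> //.
  by rewrite card_eq_le cW; exact: subset_card_le.
move=> a S Wa _ WS st.
have aH : elts a `<=` H theta by exact: tH (WA _ Wa).
have cS s : elts S s -> countable (elts s).
  by move=> Ss; have [] := st.1 (elts s) (ex_intro2 _ _ s Ss erefl).
have /Wtr : stationary_ctbl (H theta) (traces (H theta) a S).
  apply: stationaryS (stationary_lift aH st) => [Z []//|Z [cZ [s Ss sE]]].
  split=> //; exists s; split=> //; first exact: tH (WA _ WS) _ Ss.
  by move=> y _; rewrite sE.
move=> /(_ Wa WS)/(stationary_trace (card_lexx _) card_nat_setX (elts a)).
apply: stationaryS => [X []//|_ [Z [[ZW cZ] [s [Ws Ss sZ]]] <-]]; split; last first.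
  split; first exact: setSI.
  by apply: sub_countable cZ; apply: subset_card_le => x [].
exists s => //; apply/seteqP; split=> x.
  by move=> sx; apply/sZ => //; exact: ctblW Ws (cS _ Ss) _ sx.
by move=> [Zx ax]; apply/sZ => //; exact: ZW.
Qed.

(** * Formulas and their variables *)

Section Syntax.
Variable L : signature.

(** The codes only serve to show that there are countably many formulas. *)
Fixpoint tcode (t : term L) : GenTree.tree nat :=
  match t with
  | Var x => GenTree.Leaf x
  | App f a => GenTree.Node (choice.pickle f) [seq tcode (a i) | i <- enum 'I_(farity f)]
  end.

Lemma map_enum_inj (I : finType) T (f g : I -> T) :
  [seq f i | i <- enum I] = [seq g i | i <- enum I] -> f =1 g.
Proof. by move=> fg i; move/eq_in_map: fg; apply; rewrite mem_enum. Qed.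

Lemma tcode_inj : injective tcode.
Proof.
elim=> [x|f a IH] [y|g b] //= [] => [->//|/(pcan_inj choice.pickleK) e].
move: b; rewrite -e => b /map_enum_inj ab.
by congr App; apply: funext => i; exact: IH.
Qed.

Fixpoint fcode (p : formula L) : GenTree.tree nat :=
  match p with
  | FEq t u => GenTree.Node 0 [:: tcode t; tcode u]
  | FRel r a => GenTree.Node 1
      (GenTree.Leaf (choice.pickle r) :: [seq tcode (a i) | i <- enum 'I_(rarity r)])
  | FMem Z x => GenTree.Node 2 [:: GenTree.Leaf Z; GenTree.Leaf x]
  | FNot p => GenTree.Node 3 [:: fcode p]
  | FAnd p q => GenTree.Node 4 [:: fcode p; fcode q]
  | FEx x p => GenTree.Node 5 [:: GenTree.Leaf x; fcode p]
  | FStat Z p => GenTree.Node 6 [:: GenTree.Leaf Z; fcode p]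
  end.

Lemma fcode_inj : injective fcode.
Proof.
elim=> [t u|r a|Z x|p IH|p IHp q IHq|x p IH|Z p IH]
  [t' u'|r' a'|Z' x'|p'|p' q'|x' p'|Z' p'] //= [].
- by move=> /tcode_inj-> /tcode_inj->.
- move=> /(pcan_inj choice.pickleK) e; move: a'; rewrite -e => a' /map_enum_inj aa'.
  by congr FRel; apply: funext => i; exact: tcode_inj.
- by move=> -> ->.
- by move=> /IH->.
- by move=> /IHp-> /IHq->.
- by move=> -> /IH->.
- by move=> -> /IH->.
Qed.

Lemma countable_formula : countable [set: formula L].
Proof.
have : [set: formula L] #<= [set: GenTree.tree nat].
  by apply: (card_le_inj (f := fcode)) => // x y _ _; exact: fcode_inj.
by move=> /sub_countable; apply; exact: countableP.
Qed.

(** Bound variables may or may not be counted, since only the finiteness of the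
    bound matters. *)
Fixpoint tbound (t : term L) : nat :=
  match t with
  | Var x => x.+1
  | App f a => \max_(i < farity f) tbound (a i)
  end.

Fixpoint fbound (p : formula L) : nat :=
  match p with
  | FEq t u => maxn (tbound t) (tbound u)
  | FRel r a => \max_(i < rarity r) tbound (a i)
  | FMem Z x => maxn Z.+1 x.+1
  | FNot p | FEx _ p | FStat _ p => fbound p
  | FAnd p q => maxn (fbound p) (fbound q)
  end.

Lemma eval_bound T (M : structure L T) t v v' :
  (forall x, (x < tbound t)%N -> v x = v' x) -> eval M v t = eval M v' t.
Proof.
elim: t => [x|f a IH] /= vv'; first exact: vv'.
congr fint; apply: funext => i; apply: IH => x xi; apply: vv'.
exact: leq_trans xi (leq_bigmax i).
Qed.

Lemma sat_bound T (M : structure L T) p v v' w w' :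
  (forall x, (x < fbound p)%N -> v x = v' x) ->
  (forall Z, (Z < fbound p)%N -> w Z = w' Z) ->
  sat M v w p <-> sat M v' w' p.
Proof.
elim: p v v' w w' => [t u|r a|Z x|p IH|p IHp q IHq|x p IH|Z p IH] v v' w w' /= vv' ww'.
- rewrite (@eval_bound _ _ t v v') 1?(@eval_bound _ _ u v v') // => x xt; apply: vv'.
    by rewrite leq_max xt orbT.
  by rewrite leq_max xt.
- suff -> : (fun i => eval M v (a i)) = (fun i => eval M v' (a i)) by [].
  apply: funext => i; apply: eval_bound => x xi; apply: vv'.
  exact: leq_trans xi (leq_bigmax i).
- by rewrite ww' ?vv' // leq_max ltnSn ?orbT.
- by have [h1 h2] := IH v v' w w' vv' ww'; split=> n hp; apply: n; [exact: h2|exact: h1].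
- have [||p1 p2] := IHp v v' w w'.
  + by move=> x xp; apply: vv'; rewrite leq_max xp.
  + by move=> x xp; apply: ww'; rewrite leq_max xp.
  have [||q1 q2] := IHq v v' w w'.
  + by move=> x xp; apply: vv'; rewrite leq_max xp orbT.
  + by move=> x xp; apply: ww'; rewrite leq_max xp orbT.
  by split=> -[hp hq]; split; auto.
- have h a : sat M [eta v with x |-> a] w p <-> sat M [eta v' with x |-> a] w' p.
    by apply: IH => // y yp /=; case: eqP => // _; exact: vv'.
  by split=> -[a /h ?]; exists a.
- suff -> : [set X | ctbl_subsets [set: T] X /\ sat M v [eta w with Z |-> X] p] =
            [set X | ctbl_subsets [set: T] X /\ sat M v' [eta w' with Z |-> X] p] by [].
  have h X : sat M v [eta w with Z |-> X] p <-> sat M v' [eta w' with Z |-> X] p.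
    by apply: IH => // y yp /=; case: eqP => // _; exact: ww'.
  by apply/seteqP; split=> X [cX /h].
Qed.

End Syntax.

(** * From stationary sets to formulas *)

(** The whole set [A] alone is a club here. *)
Lemma stationary_countable_top T (A : set T) (S : set (set T)) :
  countable A -> stationary_ctbl A S -> S A.
Proof.
move=> cA [SA st]; have [|X [/= -> //]] := st [set A].
split=> [_ ->|a s oa [i ai] _ sA _|X [XA _]]; first by split.
  apply/seteqP; split=> x; first by move=> [j aj]; rewrite (sA j aj).
  by move=> Ax; exists i => //; rewrite (sA i ai).
by exists A.
Qed.

Lemma stationary_of_top T (A : set T) (S : set (set T)) :
  countable A -> S `<=` ctbl_subsets A -> S A -> stationary_ctbl A S.
Proof.
move=> cA SA St; split=> // C [CA _ Cub].
have [|Y CY AY] := Cub A; first by split.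
have [YA _] := CA _ CY; exists Y; split=> //.
by have -> : Y = A by apply/seteqP.
Qed.

Section SkolemHull.
Variables (L : signature) (A E : V) (M : structure L (elts A)) (a0 : elts A).
Hypothesis E0 : elts E = set0.

Lemma is_set_solutions (P : set V -> Prop) :
  is_set [set X | [/\ elts X `<=` elts A, countable (elts X) & P (elts X)]].
Proof.
have [Q QE] := V_power A; apply: (is_set_sub (x := Q)) => X [XA _ _].
by rewrite QE.
Qed.

Definition witness (x : nat) (p : formula L) v w : V :=
  if pselect (exists b : elts A, sat M [eta v with x |-> b] w p) is left h
  then val (sval (cid h)) else val a0.

Definition solutions (Z : nat) (p : formula L) v w : V :=
  sval (cid (is_set_solutions
    (fun X => sat M v [eta w with Z |-> val @^-1` X] p))).

(** Finite lists of parameters are read as assignments, completed arbitrarily. *)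
Definition asg1 (l : seq V) (i : nat) : elts A := insubd a0 (nth E l i).
Definition asg2 (l : seq V) (i : nat) : set (elts A) := val @^-1` elts (nth E l i).

(** A list [s] is split at every [i.1.1] into first and second order parameters,
    so that a single list argument provides for both. *)
Definition hull_step (s : seq V) : set V :=
  [set A; E; val a0] `|` \bigcup_(x in [set x | x \in s /\ countable (elts x)]) elts x `|`
  \bigcup_(i in [set: (nat * nat) * formula L])
    let v := asg1 (take i.1.1 s) in let w := asg2 (drop i.1.1 s) in
    [set witness i.1.2 i.2 v w; solutions i.1.2 i.2 v w].

Lemma countable_hull_step s : countable (hull_step s).
Proof.
have cU := @card_le_setU _ _ (card_lexx [set: nat]) card_nat_setX V.
apply: (cU); first apply: (cU).
- exact: finite_set_countable (finite_set3 _ _ _).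
- apply: bigcup_countable => [|x []//].
  apply: sub_countable (finite_set_countable (finite_seq s)).
  by apply: subset_card_le => x [].
- apply: bigcup_countable => [|i _].
    rewrite -setXTT; exact: countableX (countableP _) (@countable_formula L).
  exact: finite_set_countable (finite_set2 _ _).
Qed.

Lemma witness_in x p v w : elts A (witness x p v w).
Proof.
rewrite /witness; case: pselect => [h|_]; last exact/set_mem/(valP a0).
exact/set_mem/(valP (sval (cid h))).
Qed.

Lemma solutionsE Z p v w : elts (solutions Z p v w) =
  [set X | [/\ elts X `<=` elts A, countable (elts X) &
               sat M v [eta w with Z |-> val @^-1` elts X] p]].
Proof. by rewrite /solutions; case: cid. Qed.

Lemma hull_step_sub (Q : set V) : transitive_set Q -> Q A ->
  (forall S, elts S `<=` [set X | elts X `<=` elts A] -> Q S) ->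
  forall s : seq V, (forall x, x \in s -> Q x) -> hull_step s `<=` Q.
Proof.
move=> tQ QA QS s sQ x [[[[->|->]|->]|[y [ys _] yx]]|[i _ [->|->]]] //.
- by apply: QS => y; rewrite E0.
- by apply: tQ QA _ _; exact/set_mem/(valP a0).
- exact: tQ (sQ y ys) _ yx.
- exact: tQ QA _ (witness_in _ _ _ _).
- by apply: QS => X; rewrite solutionsE => -[].
Qed.

Section Closed.
Variable W : set V.
Hypothesis clW : closed_under hull_step W.

Lemma closed_base : [/\ W A, W E & W (val a0)].
Proof.
have sW : [set A; E; val a0] `<=` W.
  by move=> x x3; apply: (clW (s := [::])) => //; left; left.
by split; apply: sW; [left; left|left; right|right].
Qed.

Lemma closed_countable x : W x -> countable (elts x) -> elts x `<=` W.
Proof.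
move=> Wx cx y xy; apply: (clW (s := [:: x])) => [z|]; first by rewrite inE => /eqP->.
by left; right; exists x => //; split=> //; exact: mem_head.
Qed.

(** An infinite assignment in [W] cannot be fed into [hull_step]; its restriction
    to the variables of [p] can, at the price of changing the assignment where
    [p] does not look. *)
Lemma closed_definable (x : nat) (p : formula L) (v : nat -> elts A) (w : nat -> V) :
  (forall i, W (val (v i))) -> (forall i, W (w i)) ->
  exists (v' : nat -> elts A) (w' : nat -> set (elts A)),
  [/\ forall i, (i < fbound p)%N -> v' i = v i,
      forall i, (i < fbound p)%N -> w' i = val @^-1` elts (w i),
      W (witness x p v' w') & W (solutions x p v' w')].
Proof.
move=> Wv Ww; set N := fbound p.
pose s1 := [seq val (v i) | i <- iota 0 N]; pose s2 := [seq w i | i <- iota 0 N].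
have N1 : size s1 = N by rewrite size_map size_iota.
exists (asg1 s1), (asg2 s2).
have sW y : y \in s1 ++ s2 -> W y.
  by rewrite mem_cat => /orP[] /mapP[i _ ->].
have cW := clW sW.
split.
- move=> i iN; apply: val_inj.
  rewrite /asg1 (nth_map 0) ?size_iota // nth_iota // add0n valKd //.
- by move=> i iN; rewrite /asg2 (nth_map 0) ?size_iota // nth_iota.
- apply: cW; right; exists ((N, x), p) => //=.
  by left; rewrite -{1}N1 take_size_cat // -{1}N1 drop_size_cat.
- apply: cW; right; exists ((N, x), p) => //=.
  by right; rewrite -{1}N1 take_size_cat // -{1}N1 drop_size_cat.
Qed.

Lemma closed_witness (x : nat) (p : formula L) (v : nat -> elts A) (w : nat -> V) :
  (forall i, W (val (v i))) -> (forall i, W (w i)) ->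
  (exists b, sat M [eta v with x |-> b] (fun i => val @^-1` elts (w i)) p) ->
  exists2 b, W (val b) & sat M [eta v with x |-> b] (fun i => val @^-1` elts (w i)) p.
Proof.
move=> Wv Ww [b pb]; have [v' [w' [vE wE Wwit _]]] := closed_definable x p Wv Ww.
have eqp c : sat M [eta v with x |-> c] (fun i => val @^-1` elts (w i)) p <->
             sat M [eta v' with x |-> c] w' p.
  apply: sat_bound => i iN /=; last by rewrite wE.
  by case: eqP => // _; rewrite vE.
move: Wwit; rewrite /witness; case: pselect => [h Wc|]; last first.
  by case; exists b; exact/eqp.
by exists (sval (cid h)) => //; apply/eqp; exact: (svalP (cid h)).
Qed.

Lemma closed_solutions (Z : nat) (p : formula L) (v : nat -> elts A) (w : nat -> V) :
  (forall i, W (val (v i))) -> (forall i, W (w i)) ->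
  exists2 S, W S & elts S = [set X | [/\ elts X `<=` elts A, countable (elts X) &
    sat M v [eta (fun i => val @^-1` elts (w i)) with Z |-> val @^-1` elts X] p]].
Proof.
move=> Wv Ww; have [v' [w' [vE wE _ WS]]] := closed_definable Z p Wv Ww.
exists (solutions Z p v' w') => //; rewrite solutionsE.
have eqp X : sat M v' [eta w' with Z |-> val @^-1` elts X] p <->
    sat M v [eta (fun i => val @^-1` elts (w i)) with Z |-> val @^-1` elts X] p.
  apply: sat_bound => i iN /=; first by rewrite vE.
  by case: eqP => // _; rewrite wE.
by apply/seteqP; split=> X [? ? /eqp].
Qed.

Definition trace_set : set (elts A) := [set x | W (val x)].

(** The value of a function is the only witness for [x = f(x_0, ..., x_(n-1))]. *)
Lemma substructure_trace : substructure M trace_set.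
Proof.
have [_ WE Wa0] := closed_base.
split=> [|f a Wa]; first by constructor; exact: (SigSub (mem_set (Wa0 : trace_set a0))).
(* The variable n is the first that is not an argument of f. *)
pose n := farity f.
pose v i : elts A := if insub i is Some j then a j else a0.
have Wv i : W (val (v i)) by rewrite /v; case: insubP => // j _ _; exact: Wa.
pose p : formula L := FEq (Var L n) (App (fun i : 'I_n => Var L i)).
have pE b w : sat M [eta v with n |-> b] w p <-> b = fint M a.
  rewrite /= eqxx; suff -> : (fun i : 'I_n => if val i == n then b else v (val i)) = a by [].
  apply: funext => i; have -> : (val i == n) = false by rewrite ltn_eqF //; exact: ltn_ord.
  by rewrite /v; case: insubP => [j _ /val_inj->|] //; rewrite ltn_ord.
have [|c Wc /pE ca] := @closed_witness n p v (fun=> E) Wv (fun=> WE).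
  by exists (fint M a); apply/pE.
by rewrite /trace_set /= -ca.
Qed.

End Closed.
End SkolemHull.

Section Transfer.
Variables (L : signature) (A E : V) (M : structure L (elts A)) (a0 : elts A).
Variable W : set V.
Hypothesis clW : closed_under (hull_step E M a0) W.

Let N := @trace_set A W.
Hypothesis hN : substructure M N.
Let j (x : N) : V := val (val x).

Lemma eval_restrict (v : nat -> N) t :
  val (eval (restrict hN) v t) = eval M (val \o v) t.
Proof.
elim: t => [//|f a IH] /=; congr fint; apply: funext => i; exact: IH.
Qed.

Let W_val (x : N) : W (j x).
Proof. exact: set_mem (valP x). Qed.

Lemma comp_delta T T' (g : T -> T') (v : nat -> T) x b :
  g \o [eta v with x |-> b] = [eta (g \o v) with x |-> g b].
Proof. by apply: funext => y /=; case: eqP. Qed.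

(** Closure under witnesses is the Tarski-Vaught test, for assignments of
    elements of [W] to the second order variables. *)
Lemma sat_restrict_first_order p (v : nat -> N) (w : nat -> V) :
  no_stat p -> (forall i, W (w i)) ->
  sat M (val \o v) (fun i => val @^-1` elts (w i)) p <->
  sat (restrict hN) v (fun i => j @^-1` elts (w i)) p.
Proof.
move=> + Ww; elim: p v => [t u|r a|Z x|p IH|p IHp q IHq|x p IH|//] v /=.
- move=> _; rewrite -!eval_restrict; split=> [/val_inj//|->//].
- move=> _; suff -> : (fun i => eval M (val \o v) (a i)) =
    (fun i => val (eval (restrict hN) v (a i))) by [].
  by apply: funext => i; rewrite eval_restrict.
- by [].
- by move=> /IH h; split=> n /h.
- by move=> /andP[/IHp hp /IHq hq]; split=> -[/hp ? /hq ?].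
- move=> /IH h; split=> [|[b /h]]; last by rewrite comp_delta; exists (val b).
  move=> /(closed_witness clW (fun i => W_val (v i)) Ww)[b Wb pb].
  exists (SigSub (mem_set (Wb : N b))); apply/h; by rewrite comp_delta.
Qed.

Hypothesis reflect : forall S, ~ countable (elts A) -> W S ->
  stationary_ctbl (elts A) (elts @` elts S) ->
  stationary_ctbl (W `&` elts A)
    ((elts @` (elts S `&` W)) `&` ctbl_subsets (W `&` elts A)).

(** For countable [A] the set [A] itself is an element of [W] and belongs to every
    stationary set, and its being a member of the trace makes the trace
    stationary. *)
Lemma reflect_any S : W S -> stationary_ctbl (elts A) (elts @` elts S) ->
  stationary_ctbl (W `&` elts A)
    ((elts @` (elts S `&` W)) `&` ctbl_subsets (W `&` elts A)).
Proof.
move=> WS st; have [cA|nA] := pselect (countable (elts A)); last exact: reflect.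
have [WA _ _] := closed_base clW.
have AW : W `&` elts A = elts A by rewrite setIidr //; exact: (closed_countable clW WA cA).
rewrite AW; apply: (stationary_of_top cA); first by move=> X [].
have [X SX /V_ext XA] := stationary_countable_top cA st.
split; last by split.
by exists A => //; split=> //; rewrite -XA.
Qed.

Lemma range_j : range j = W `&` elts A.
Proof.
rewrite range_val_val; apply/seteqP; split=> [_ [x Wx <-]|x [Wx Ax]].
  by split=> //; exact/set_mem/(valP x).
by exists (SigSub (mem_set Ax)).
Qed.

(** The second order parameters are kept as elements [w i] of [W], since the
    solutions of [p] form an element of [W] only for such parameters; [reflect]
    yields new ones of the same kind. *)
Lemma sat_restrict_Pi11 p (v : nat -> N) (w : nat -> V) :
  Pi11 p -> (forall i, W (w i)) ->
  sat M (val \o v) (fun i => val @^-1` elts (w i)) p ->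
  sat (restrict hN) v (fun i => j @^-1` elts (w i)) p.
Proof.
move=> hp; elim: hp w => [{}p np|Z {}p _ IH] w Ww.
  by apply: (sat_restrict_first_order _ _ _).1.
move=> /= st.
have [S WS SE] := closed_solutions clW Z p (fun i => W_val (v i)) Ww.
have AS : stationary_ctbl (elts A) (elts @` elts S).
  have := stationary_image card_nat_setX (@val_inj _ _ _ : injective (val : elts A -> V)) st.
  rewrite range_val_set; apply: stationaryS => [_ [X + <-]|_ [X [[_ cX] pX] <-]].
    by rewrite SE => -[].
  have XA : val @` X `<=` elts A by move=> _ [x _ <-]; exact/set_mem/(valP x).
  have [Y YE] := is_set_sub XA; exists Y => //; rewrite SE /= YE; split=> //.
    exact: card_le_trans (card_image_le _ _) cX.
  suff -> : val @^-1` (val @` X) = X by [].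
  by apply/seteqP; split=> [x [y Xy /val_inj<-]//|x Xx]; exists x.
have jI : injective j by move=> x y /val_inj/val_inj.
have := reflect_any WS AS; rewrite -range_j => /(stationary_preimage card_nat_setX jI).
apply: stationaryS => [X []//|_ [_ [[X [SX WX] <-] [_ cX]] <-]].
move: SX; rewrite SE => -[XA _ pX]; split.
  split=> //; apply: card_le_trans cX.
  by apply: (card_le_inj (f := j)) => // x y _ _; exact: jI.
have dE T (g : T -> V) : (fun i => g @^-1` elts ([eta w with Z |-> X] i)) =
    [eta (fun i => g @^-1` elts (w i)) with Z |-> g @^-1` elts X].
  by apply: funext => i /=; case: eqP.
rewrite -dE; apply: IH; last by rewrite dE.
by move=> i /=; case: eqP.
Qed.

End Transfer.

(** The Hartogs number of [Y := nat -> D -> Prop] is regular, because pairs of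
    functions on [nat] can be interleaved into one; and [D] is large enough for
    [K] and [theta0] to embed into [Y]. *)
Lemma regular_above (K theta0 : V) : transitive_set (elts K) -> ordinal_V theta0 ->
  exists theta, [/\ regular_V theta, elts theta theta0 & elts K `<=` H theta].
Proof.
move=> tK otheta0.
have [D1 KD] := card_le_small_type K.
have [D2 tD] := card_le_small_type theta0.
pose D := (D1 + D2 + nat)%type; pose Y := nat -> D -> Prop.
have DY : [set: D] #<= [set: Y].
  apply: (card_le_inj (f := fun d (_ : nat) e => e = d)) => // x y _ _.
  by move=> /(congr1 (fun f => f 0 x)) /= <-.
have KY : elts K #<= [set: Y].
  apply: card_le_trans KD _; apply: card_le_trans DY.
  by apply: (card_le_inj (f := fun d => inl (inl d))) => // x y _ _ [].
have tY : elts theta0 #<= [set: Y].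
  apply: card_le_trans tD _; apply: card_le_trans DY.
  by apply: (card_le_inj (f := fun d => inl (inr d))) => // x y _ _ [].
have nY : [set: nat] #<= [set: Y].
  apply: card_le_trans DY.
  by apply: (card_le_inj (f := fun d => inr d)) => // x y _ _ [].
have sqY : [set: Y] `*` [set: Y] #<= [set: Y].
  apply: (card_le_inj (f := fun (q : Y * Y) n d =>
    if odd n then q.1 n./2 d else q.2 n./2 d)) => // -[x x'] [y y'] _ _ e.
  congr pair; apply: funext => n.
    by have := congr1 (fun f => f n.*2.+1) e; rewrite /= odd_double /= uphalf_double.
  by have := congr1 (fun f => f n.*2) e; rewrite /= odd_double /= doubleK.
have [theta tE] := hartogs_exists ((fun _ _ => True) : Y).
exists theta; split.
- exact: hartogs_regular tE nY sqY.
- by rewrite tE.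
- move=> x Kx; have xK : trcl x `<=` elts K by apply: trcl_min => //; exact: tK.
  have xY := card_le_trans (subset_card_le xK) KY.
  apply/andP; split; first exact: card_le_trans xY (hartogs_ge tE).
  by apply/negP => tx; apply: (hartogs_not_le tE); exact: card_le_trans tx xY.
Qed.

Lemma DRP_LST : DRP_internal -> Pi11_LST.
Proof.
move=> [theta0 [otheta0 DRP]] L A M.
have [P PE] := V_power A; have [PP PPE] := V_power P.
have [K tK PPK] := in_transitive_set PP.
have [theta [rtheta ttheta0 KH]] := regular_above tK otheta0.
have [E E0] := is_set0; have [a0] := nonempty M.
have KA : elts K A.
  have KP : elts K P by apply: PPK; rewrite PPE.
  by apply: (tK _ KP); rewrite PE.
have KS S : elts S `<=` [set X | elts X `<=` elts A] -> elts K S.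
  by move=> SA; apply: PPK; rewrite PPE PE.
have [|W [[_ clW] [_ cW wW refl]]] := (DRP theta rtheta ttheta0).2 _
    (club_closed_under nat_le_omega1 omega1_setX (G := hull_step E M a0) (A := H theta) _).
  move=> s sH; split.
    by apply: hull_step_sub => // [||S /KS/KH //]; [exact: transitive_H|exact: KH].
  exact: (countable_card_le nat_le_omega1) (countable_hull_step _ _ _ _).
have [WA WE _] := closed_base clW.
have hN := substructure_trace clW.
exists (@trace_set A W), hN; split.
  apply: (@card_le_trans _ _ _ W); last by move: cW; rewrite card_eq_le => /andP[].
  by apply: (card_le_inj (f := val)) => // x y _ _; exact: val_inj.
move=> p hp _ v pv.
have set0E T (g : T -> V) : (fun i : nat => g @^-1` elts E) = fun=> set0.
  by apply: funext => i; rewrite E0 preimage_set0.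
have := @sat_restrict_Pi11 _ _ _ M a0 W clW hN _ p v (fun=> E) hp (fun=> WE).
rewrite !set0E; apply=> // S nA WS st; exact: refl.
Qed.

Theorem theorem1p2 : Pi11_LST <-> DRP_internal.
Proof. by split; [exact: LST_DRP|exact: DRP_LST]. Qed.
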